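(* Let $d\in\mathbb N$, $L,a\in\mathbb R$, $b\in(a,\infty)$, $R\in[\max\{2,L,|a|,|b|\},\infty)$, let $(\Omega,\mathcal F,\mathbb P)$ be a probability space, let $X_m\colon\Omega\to[a,b]^d$, $m\in\mathbb N$, be i.i.d. random variables, let $\|\cdot\|$ be the standard (Euclidean) norm on $\mathbb R^d$, and let $\varphi\colon[a,b]^d\to[0,1]$ satisfy $|\varphi(x)-\varphi(y)|\le L\|x-y\|$ for all $x,y\in[a,b]^d$. For $\mathfrak d,M\in\mathbb N$, $\tau\in\{3,4,\dots\}$ with $\mathfrak d\ge\tau(d+1)+(\tau-3)\tau(\tau+1)+\tau+1$, $\theta\in[-R,R]^{\mathfrak d}$ and $\omega\in\Omega$ let $$\mathfrak E_{\mathfrak d,M,\tau}(\theta,\omega)=\frac1M\sum_{m=1}^M\bigl|\mathcal N^{\theta,\tau}(X_m(\omega))-\varphi(X_m(\omega))\bigr|^2 .$$ For every $\mathfrak d\in\mathbb N$ let $\Theta_{\mathfrak d,k}\colon\Omega\to[-R,R]^{\mathfrak d}$, $k\in\mathbb N$, be i.i.d. random variables with $\Theta_{\mathfrak d,1}$ continuous uniformly distributed on $[-R,R]^{\mathfrak d}$, and for $\mathfrak d,K,M,\tau\in\mathbb N$ let $\Xi_{\mathfrak d,K,M,\tau}=\Theta_{\mathfrak d,k^*}$ where $k^*=\min\{k\in\{1,\dots,K\}\colon \mathfrak E_{\mathfrak d,M,\tau}(\Theta_{\mathfrak d,k})=\min_{j\in\{1,\dots,K\}}\mathfrak E_{\mathfrak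 d,M,\tau}(\Theta_{\mathfrak d,j})\}$. Then there exists $c\in(0,\infty)$ such that for all $\mathfrak d,K,M,\tau\in\mathbb N$ and $\varepsilon\in(0,1]$ with $\tau\ge 2d(2dL(b-a)\varepsilon^{-1}+2)^d$ and $\mathfrak d\ge\tau(d+1)+(\tau-3)\tau(\tau+1)+\tau+1$ it holds that $$\mathbb P\Bigl(\int_{[a,b]^d}\bigl|\mathcal N^{\Xi_{\mathfrak d,K,M,\tau},\tau}(x)-\varphi(x)\bigr|\,\mathbb P_{X_1}(dx)>\varepsilon\Bigr)\le \exp\bigl(-K(c\tau)^{-\tau\mathfrak d}\varepsilon^{2\mathfrak d}\bigr)+2\exp\Bigl(\mathfrak d\ln\bigl((c\tau)^\tau\varepsilon^{-2}\bigr)-\frac{\varepsilon^4M}{c}\Bigr).$$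
   Context: For $r,s\in\mathbb N$, $k\in\mathbb N_0$ and $\theta=(\theta_1,\dots,\theta_{\mathfrak d})\in\mathbb R^{\mathfrak d}$ with $\mathfrak d\ge k+rs+r$, let $\mathcal A^{\theta,k}_{r,s}\colon\mathbb R^s\to\mathbb R^r$ be the affine map whose $i$-th component ($i=1,\dots,r$) is $x\mapsto\sum_{j=1}^s\theta_{k+(i-1)s+j}x_j+\theta_{k+rs+i}$. Let $\mathfrak c(y)=\min\{1,\max\{0,y\}\}$ for $y\in\mathbb R$ and let $\mathfrak R_\tau\colon\mathbb R^\tau\to\mathbb R^\tau$ apply $y\mapsto\max\{y,0\}$ componentwise. For $\mathfrak d,\tau\in\{3,4,\dots\}$ and $\theta\in\mathbb R^{\mathfrak d}$ with $\mathfrak d\ge\tau(d+1)+(\tau-3)\tau(\tau+1)+\tau+1$, the function $\mathcal N^{\theta,\tau}\colon\mathbb R^d\to\mathbb R$ is $$\mathcal N^{\theta,\tau}=\mathfrak c\circ\mathcal A^{\theta,\tau(d+1)+(\tau-3)\tau(\tau+1)}_{1,\tau}\circ\mathfrak R_\tau\circ\mathcal A^{\theta,\tau(d+1)+(\tau-4)\tau(\tau+1)}_{\tau,\tau}\circ\mathfrak R_\tau\circ\cdots\circ\mathcal A^{\theta,\tau(d+1)}_{\tau,\tau}\circ\mathfrak R_\tau\circ\mathcal A^{\theta,0}_{\tau,d},$$ i.e. a ReLU network with input dimension $d$, $\tau-2$ hidden layers of width $\tau$ (there are $\tau-3$ maps $\mathcal A^{\theta,\tau(d+1)+(j-1)\tau(\tau+1)}_{\tau,\tau}$,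 $j=1,\dots,\tau-3$), one output, and output clipped to $[0,1]$. *)

(* Defs.v *)
From HB Require Import structures.
From mathcomp Require Import all_boot all_order all_algebra.
From mathcomp Require Import all_classical all_reals all_analysis.
Set Implicit Arguments. Unset Strict Implicit. Unset Printing Implicit Defensive.
Import Order.TTheory GRing.Theory Num.Theory.
Local Open Scope classical_set_scope.
Local Open Scope ring_scope.

Section Defs.
Variable R : realType.

(* parameter theta_n (1-based index n in the paper) is [nth 0 th n.-1];
   we use 0-based indices: theta_{n+1} = nth 0 th n *)
Definition par (th : seq R) (n : nat) : R := nth 0 th n.

Definition affine (r s k : nat) (th : seq R) (x : 'I_s -> R) : 'I_r -> R :=
  fun i => \sum_(j < s) par th (k + i * s + j) * x j + par th (k + r * s + i).

Arguments affine : clear implicits.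

Definition relu (n : nat) (x : 'I_n -> R) : 'I_n -> R :=
  fun i => Num.max (x i) 0.

Definition clip (y : R) : R := Num.min 1 (Num.max 0 y).

Fixpoint hidden (d tau : nat) (th : seq R) (x : 'I_d -> R) (j : nat)
  : 'I_tau -> R :=
  match j with
  | 0 => relu (affine tau d 0 th x)
  | j'.+1 => relu (affine tau tau (tau * (d + 1) + j' * (tau * (tau + 1))) th
                          (@hidden d tau th x j'))
  end.

Arguments hidden : clear implicits.

Definition realization (d tau : nat) (th : seq R) (x : d.-tuple R) : R :=
  clip (affine 1 tau (tau * (d + 1) + (tau - 3) * (tau * (tau + 1))) th
          (hidden d tau th (fun j => tnth x j) (tau - 3)) ord0).

Definition cube (n : nat) (a b : R) : set (n.-tuple R) :=
  [set x | forall i, a <= tnth x i <= b].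

Definition eucl_dist (n : nat) (x y : n.-tuple R) : R :=
  Num.sqrt (\sum_(i < n) (tnth x i - tnth y i) ^+ 2).

Context {d0 : measure_display} {T : measurableType d0}.

Definition mutually_independent {d1} {T' : measurableType d1}
  (P : probability T R) (Y : nat -> T -> T') : Prop :=
  forall (S : seq nat) (B : nat -> set T'), uniq S ->
    (forall i, i \in S -> measurable (B i)) ->
    P (\bigcap_(i in [set i | i \in S]) (Y i @^-1` B i)) =
    (\prod_(i <- S) P (Y i @^-1` B i))%E.

Definition identically_distributed {d1} {T' : measurableType d1}
  (P : probability T R) (Y : nat -> T -> T') : Prop :=
  forall i (B : set T'), measurable B -> P (Y i @^-1` B) = P (Y 0 @^-1` B).

Definition iid {d1} {T' : measurableType d1}
  (P : probability T R) (Y : nat -> T -> T') : Prop :=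
  (forall i, measurable_fun setT (Y i)) /\
  mutually_independent P Y /\ identically_distributed P Y.

(* continuous uniform distribution on [-r, r]^D: the law of Z is the
   normalized D-dimensional Lebesgue measure restricted to the cube, i.e.
   the product measure of the normalized 1-dimensional Lebesgue measures
   (characterized on measurable rectangles). *)
Definition uniform_on_cube (D : nat) (r : R) (P : probability T R)
  (Z : T -> D.-tuple R) : Prop :=
  forall B : 'I_D -> set R, (forall i, measurable (B i)) ->
    P (Z @^-1` [set t | forall i, B i (tnth t i)]) =
    (\prod_(i < D) (lebesgue_measure (B i `&` `[(- r)%R, r]%classic) * ((2 * r)^-1)%R%:E))%E.

(* X m is the paper's X_{m+1};  Th k is the paper's Theta_{D,k+1}. *)

Definition emp_risk (d : nat) (phi : d.-tuple R -> R) (X : nat -> T -> d.-tuple R)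
  (M tau : nat) (th : seq R) (w : T) : R :=
  M%:R^-1 * \sum_(m < M) (realization tau th (X m w) - phi (X m w)) ^+ 2.

(* k^* - 1 : the smallest (0-based) k < K with E(Th k) = min_{j<K} E(Th j) *)
Definition kstar (d D : nat) (phi : d.-tuple R -> R) (X : nat -> T -> d.-tuple R)
  (Th : nat -> T -> D.-tuple R) (K M tau : nat) (w : T) : nat :=
  find (fun k => [forall j : 'I_K,
          emp_risk phi X M tau (Th k w) w <= emp_risk phi X M tau (Th j w) w])
       (iota 0 K).

Definition Xi (d D : nat) (phi : d.-tuple R -> R) (X : nat -> T -> d.-tuple R)
  (Th : nat -> T -> D.-tuple R) (K M tau : nat) (w : T) : D.-tuple R :=
  Th (kstar phi X Th K M tau w) w.

End Defs.

(* Main.v *)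
(** The error of the trained network is controlled by three estimates.
    Approximation: on [a,b]^d the McShane-type maximum of finitely many cones
    phi(q) - L |x - q|_1, q ranging over the midpoints of a grid with n cells per side,
    is within L d (b - a) / n <= eps / 2 of phi.  A ReLU network computes the coordinate
    distances |x_i - q_i| in its first layer and then updates the running maximum once per
    layer, s' = s + relu(cone - s); its depth tau - 2 exceeds the n^d grid points.
    Optimization: theta |-> N^theta is Lipschitz for the sup norms with a constant
    Lam <= (c tau)^(tau - 1), so it suffices that one of the K uniform samples falls in a box of
    side eps / (4 Lam) around the approximating parameter.
    Generalization: a one-sided Chernoff bound at the centers of a grid of mesh
    eps^2 / (16 Lam) in parameter space, and Lipschitz continuity in between.
    The passage from the L^2 to the L^1 error is u <= eps / 2 + u^2 / (2 eps). *)
Require Import Defs.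
From HB Require Import structures.
From mathcomp Require Import all_boot all_order all_algebra.
From mathcomp Require Import all_classical all_reals all_analysis measurable_realfun.
From mathcomp Require Import ring lra zify.
Set Implicit Arguments. Unset Strict Implicit. Unset Printing Implicit Defensive.
Import Order.TTheory GRing.Theory Num.Theory.
Local Open Scope classical_set_scope.
Local Open Scope ring_scope.

(** * Lipschitz dependence on the parameters *)

Lemma clip_lip (R : realType) (x y : R) : `|clip x - clip y| <= `|x - y|.
Proof.
have cE (z : R) : clip z = if z < 0 then 0 else if 1 < z then 1 else z.
  rewrite /clip; case: (ltP z 0) => hz; last by case: (ltP 1 z).
  by rewrite min_r.
have h1 := ler_norm (x - y); have h2 := ler_norm (- (x - y)); rewrite normrN in h2.
rewrite !cE ler_norml; case: (ltP x 0) => hx; case: (ltP y 0) => hy;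
  case: (ltP 1 x) => hx1; case: (ltP 1 y) => hy1; lra.
Qed.

Lemma clip_ge0_le1 (R : realType) (x : R) : 0 <= clip x <= 1.
Proof. by rewrite /clip le_min ge_min le_max ler01 !lexx. Qed.

Lemma realization_ge0_le1 (R : realType) (d tau : nat) (th : seq R) (x : d.-tuple R) :
  0 <= realization tau th x <= 1.
Proof. exact: clip_ge0_le1. Qed.

Lemma relu_lip (R : realType) (n : nat) (x y : 'I_n -> R) (i : 'I_n) :
  `|relu x i - relu y i| <= `|x i - y i|.
Proof.
have h1 := ler_norm (x i - y i); have h2 := ler_norm (- (x i - y i)).
rewrite normrN in h2.
by rewrite /relu ler_norml; case: (ltP (x i) 0) => hx; case: (ltP (y i) 0) => hy; lra.
Qed.

Lemma relu_norm (R : realType) (n : nat) (x : 'I_n -> R) (i : 'I_n) :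
  `|relu x i| <= `|x i|.
Proof.
rewrite /relu; case: (ltP (x i) 0) => hx //.
by rewrite normr0.
Qed.

Lemma affine_norm (R : realType) (r s k : nat) (th : seq R) (x : 'I_s -> R) (i : 'I_r)
  (B A : R) :
  (forall n, `|par th n| <= B) -> (forall j, `|x j| <= A) ->
  `|affine k th x i| <= s%:R * (B * A) + B.
Proof.
move=> hth hx; rewrite /affine.
apply: (le_trans (ler_normD _ _)); apply: lerD => //.
apply: (le_trans (ler_norm_sum _ _ _)).
rewrite mulr_natl -[X in _ <= _ *+ X]card_ord -sumr_const.
by apply: ler_sum => j _; rewrite normrM ler_pM.
Qed.

Lemma affine_lip (R : realType) (r s k : nat) (th th' : seq R) (x x' : 'I_s -> R)
  (i : 'I_r) (B A Dx del : R) :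
  (forall n, `|par th' n| <= B) -> (forall j, `|x j| <= A) ->
  (forall j, `|x j - x' j| <= Dx) ->
  (forall n, `|par th n - par th' n| <= del) ->
  `|affine k th x i - affine k th' x' i| <= s%:R * (B * Dx + A * del) + del.
Proof.
move=> hth hx hD hdel; rewrite /affine opprD addrACA.
apply: (le_trans (ler_normD _ _)); apply: lerD => //.
rewrite -sumrB; apply: (le_trans (ler_norm_sum _ _ _)).
rewrite mulr_natl -[X in _ <= _ *+ X]card_ord -sumr_const.
apply: ler_sum => j _.
have -> : par th (k + i * s + j) * x j - par th' (k + i * s + j) * x' j =
  par th' (k + i * s + j) * (x j - x' j) +
  x j * (par th (k + i * s + j) - par th' (k + i * s + j)) by ring.
apply: (le_trans (ler_normD _ _)); rewrite !normrM.
by apply: lerD; apply: ler_pM.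
Qed.

Lemma hidden0E (R : realType) (d tau : nat) (th : seq R) (x : 'I_d -> R) (i : 'I_tau) :
  hidden th x 0 i = relu (affine 0 th x) i.
Proof. by []. Qed.

Lemma hiddenSE (R : realType) (d tau : nat) (th : seq R) (x : 'I_d -> R) (j : nat)
  (i : 'I_tau) :
  hidden th x j.+1 i =
  relu (affine (tau * (d + 1) + j * (tau * (tau + 1))) th (@hidden R d tau th x j)) i.
Proof. by []. Qed.

(** Since the bound [A] of one layer is at least 1, the next layer obeys
    [tau * (B * A) + B <= (tau + 1) * B * A], so the bound grows by the factor [(tau + 1) * B] per
    layer. *)
Lemma hidden_norm (R : realType) (d tau : nat) (th : seq R) (x : 'I_d -> R) (B : R)
  (j : nat) (i : 'I_tau) :
  1 <= B -> (forall n, `|par th n| <= B) -> (forall k, `|x k| <= B) ->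
  `|hidden th x j i| <= (d.+1%:R * B ^+ 2) * ((tau.+1)%:R * B) ^+ j.
Proof.
move=> B1 hth hx; have B0 : 0 <= B by lra.
elim: j i => [|j IH] i; rewrite ?hidden0E ?hiddenSE;
  apply: (le_trans (relu_norm _ _)).
  apply: (le_trans (affine_norm _ _ hth hx)).
  rewrite expr0 mulr1 -natr1 -expr2.
  have : 0 <= d%:R :> R by [].
  rewrite expr2; nra.
apply: (le_trans (affine_norm _ _ hth IH)).
rewrite [_ ^+ j.+1]exprS; set A := _ * _ ^+ j.
have A1 : 1 <= A.
  rewrite /A; apply: mulr_ege1; first by apply: mulr_ege1; rewrite ?ler1n // exprn_ege1.
  by apply: exprn_ege1; apply: mulr_ege1; rewrite ?ler1n.
rewrite [X in _ <= X]mulrCA -/A -[tau.+1%:R]natr1.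
have : 0 <= tau%:R :> R by [].
nra.
Qed.

(** The constant is the number [j.+1] of affine maps times the size bound of [hidden_norm]: a new
    layer multiplies the inherited error by at most [(tau + 1) * B] and adds an error of its own of
    at most the new size bound times [del]. *)
Lemma hidden_lip (R : realType) (d tau : nat) (th th' : seq R) (x : 'I_d -> R)
  (B del : R) (j : nat) (i : 'I_tau) :
  1 <= B -> (forall n, `|par th n| <= B) -> (forall n, `|par th' n| <= B) ->
  (forall k, `|x k| <= B) ->
  (forall n, `|par th n - par th' n| <= del) ->
  `|hidden th x j i - hidden th' x j i| <=
    j.+1%:R * ((d.+1%:R * B ^+ 2) * ((tau.+1)%:R * B) ^+ j) * del.
Proof.
move=> B1 hth hth' hx hdel; have B0 : 0 <= B by lra.
have del0 : 0 <= del by apply: le_trans (hdel 0%N).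
elim: j i => [|j IH] i; rewrite ?hidden0E ?hiddenSE;
  apply: (le_trans (relu_lip _ _ _)).
  have h0 : forall k, `|x k - x k| <= 0 by move=> k; rewrite subrr normr0.
  apply: (le_trans (affine_lip _ _ hth' hx h0 hdel)).
  rewrite expr0 mulr1 mul1r -natr1 mulr0 add0r.
  have d0 : 0 <= d%:R :> R by [].
  have BB : B <= B ^+ 2 by apply: ler_eXnr.
  have : d%:R * B + 1 <= (d%:R + 1) * B ^+ 2 by have := ler_wpM2l d0 BB; lra.
  by move=> /(ler_wpM2r del0); rewrite mulrDl mul1r mulrA.
apply: (le_trans (affine_lip _ _ hth' (fun k => hidden_norm _ k B1 hth hx) IH hdel)).
rewrite [_ ^+ j.+1]exprS; set A := _ * _ ^+ j.
have A1 : 1 <= A.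
  rewrite /A; apply: mulr_ege1; first by apply: mulr_ege1; rewrite ?ler1n // exprn_ege1.
  by apply: exprn_ege1; apply: mulr_ege1; rewrite ?ler1n.
rewrite [(d.+1)%:R * _ * (_ * _)]mulrCA -/A.
rewrite -[in j.+2%:R]natr1 -[tau.+1%:R]natr1.
have t0 : 0 <= tau%:R :> R by [].
have j1 : 0 <= j.+1%:R :> R by [].
set t := tau%:R; set k := j.+1%:R.
have -> : t * (B * (k * A * del) + A * del) + del =
  (t * (B * (k * A) + A) + 1) * del by ring.
apply: ler_wpM2r => //.
have A0 : 0 <= A := le_trans ler01 A1.
have tA : 0 <= t * A by rewrite mulr_ge0.
have kAB : 0 <= k * (A * B) by apply: mulr_ge0 => //; apply: mulr_ge0.
have : t * A <= t * A * B by rewrite ler_peMr.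
have : 1 <= A * B by apply: mulr_ege1.
nra.
Qed.

(** Of the exponent [tau.-1], [tau - 3] powers come from the size bound of the last hidden layer,
    one from the output layer, and one absorbs the number of layers, which [hidden_lip] carries as a
    factor. *)
Definition lip_cst (R : realType) (d tau : nat) (B : R) : R :=
  (d.+1%:R * B ^+ 2) * ((tau.+1)%:R * B) ^+ tau.-1.

Lemma lip_cst_ge1 (R : realType) (d tau : nat) (B : R) : 1 <= B -> 1 <= lip_cst d tau B.
Proof.
move=> B1; rewrite /lip_cst.
apply: mulr_ege1; first by apply: mulr_ege1; rewrite ?ler1n // exprn_ege1.
by apply: exprn_ege1; apply: mulr_ege1; rewrite ?ler1n.
Qed.

Lemma realization_lip (R : realType) (d tau : nat) (th th' : seq R) (x : d.-tuple R)
  (B del : R) :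
  (2 < tau)%N ->
  1 <= B -> (forall n, `|par th n| <= B) -> (forall n, `|par th' n| <= B) ->
  (forall k, `|tnth x k| <= B) ->
  (forall n, `|par th n - par th' n| <= del) ->
  `|realization tau th x - realization tau th' x| <= lip_cst d tau B * del.
Proof.
move=> t3 B1 hth hth' hx hdel; have B0 : 0 <= B by lra.
have del0 : 0 <= del by apply: le_trans (hdel 0%N).
apply: (le_trans (clip_lip _ _)).
set n := (tau - 3)%N; have e : tau = n.+3 by rewrite /n; lia.
clearbody n.
apply: (le_trans (affine_lip _ _ hth' (fun k => hidden_norm _ k B1 hth hx)
  (fun k => hidden_lip _ k B1 hth hth' hx hdel) hdel)).
rewrite /lip_cst e /=.
rewrite [_ ^+ n.+2]exprS [_ ^+ n.+1]exprS.
set A := _ * _ ^+ n.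
have A1 : 1 <= A.
  rewrite /A; apply: mulr_ege1; first by apply: mulr_ege1; rewrite ?ler1n // exprn_ege1.
  by apply: exprn_ege1; apply: mulr_ege1; rewrite ?ler1n.
set t := n.+3%:R.
have -> : n.+1%:R = t - 2 :> R by rewrite /t -[n.+3%:R]natr1 -[n.+2%:R]natr1; ring.
have -> : n.+4%:R = t + 1 :> R by rewrite natr1.
have t3R : 3 <= t by rewrite /t ler_nat.
have -> : d.+1%:R * B ^+ 2 * ((t + 1) * B * ((t + 1) * B * ((t + 1) * B) ^+ n)) =
  (t + 1) * B * ((t + 1) * B) * A by rewrite /A -[n.+4%:R]natr1 -/t; ring.
have -> : t * (B * ((t - 2) * A * del) + A * del) + del =
  (t * (B * ((t - 2) * A) + A) + 1) * del by ring.
apply: ler_wpM2r => //.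
have A0 : 0 <= A := le_trans ler01 A1.
have AB : A <= A * B by rewrite ler_peMr.
have AB2 : A * B <= A * B * B by rewrite ler_peMr // mulr_ge0.
have -> : (t + 1) * B * ((t + 1) * B) * A = (t+1) * (t+1) * (A * B * B) by ring.
have -> : t * (B * ((t - 2) * A) + A) + 1 = t * (t-2) * (A * B) + t * A + 1 by ring.
have h1 : t * (t - 2) * (A * B) <= t * (t - 2) * (A * B * B).
  by apply: ler_wpM2l => //; nra.
have h2 : t * A <= t * (A * B * B) by apply: ler_wpM2l; lra.
have : 0 <= (3 * t) * (A * B * B) by apply: mulr_ge0; lra.
nra.
Qed.

(** Brings the constant to the form of a multiple of [tau] raised to [tau.-1]: the factor
    [d.+1 * B ^ 2] is at least 1, so it may be raised to that power as well. *)
Lemma lip_cst_le (R : realType) (d tau : nat) (B : R) : (2 < tau)%N -> 1 <= B ->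
  lip_cst d tau B <= (2 * d.+1%:R * B ^+ 3 * tau%:R) ^+ tau.-1.
Proof.
move=> t3 B1; rewrite /lip_cst.
have B0 : 0 <= B by lra.
have c1 : 1 <= d.+1%:R * B ^+ 2 :> R by apply: mulr_ege1; rewrite ?ler1n // exprn_ege1.
have -> : 2 * d.+1%:R * B ^+ 3 * tau%:R = (d.+1%:R * B ^+ 2) * (2 * tau%:R * B) by ring.
rewrite [leRHS]exprMn; apply: ler_pM => //.
- exact: le_trans ler01 c1.
- by apply: exprn_ge0; apply: mulr_ge0.
- by apply: ler_eXnr => //; lia.
- have h : tau.+1%:R * B <= 2 * tau%:R * B.
    by apply: ler_wpM2r => //; rewrite -natrM ler_nat; lia.
  by apply: lerXn2r => //; rewrite nnegrE !mulr_ge0.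
Qed.

(** * Concentration for independent samples *)

(** By [1 + y <= expR y] the left side is at most [1 / (1 + y)], and [(1 + y) * (1 - y + y ^ 2) = 1
    + y ^ 3 >= 1]. *)
Lemma expRN_le (R : realType) (y : R) : 0 <= y -> expR (- y) <= 1 - y + y ^+ 2.
Proof.
move=> y0; rewrite expRN.
have h1 : 0 < 1 + y by lra.
apply: (@le_trans _ _ (1 + y)^-1).
  by rewrite lef_pV2 ?posrE ?expR_gt0 // expR_ge1Dx.
rewrite -[leLHS]mul1r ler_pdivrMr //.
have : 0 <= y * y * y by rewrite !mulr_ge0.
nra.
Qed.

Lemma measure_bigU_le (R : realType) (d0 : measure_display) (T : measurableType d0)
  (P : {measure set T -> \bar R}) (I : Type) (s : seq I) (Q : pred I) (F : I -> set T) :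
  (forall i, measurable (F i)) ->
  (P (\big[setU/set0]_(i <- s | Q i) F i) <= \sum_(i <- s | Q i) P (F i))%E.
Proof.
move=> mF; elim: s => [|i s IH]; first by rewrite !big_nil measure0.
rewrite !big_cons; case: ifP => // _.
have mU : measurable (\big[setU/set0]_(j <- s | Q j) F j) by exact: bigsetU_measurable.
by apply: (le_trans (measureU2 P (mF i) mU)); exact: leeD.
Qed.

Lemma iid_prod (R : realType) (d0 d1 : measure_display) (T : measurableType d0)
  (T' : measurableType d1) (P : probability T R) (Y : nat -> T -> T') (M : nat)
  (B : 'I_M -> set T') :
  iid P Y -> (forall m, measurable (B m)) ->
  P [set w | forall m : 'I_M, B m (Y m w)] = (\prod_(m < M) P (Y 0%N @^-1` B m))%E.
Proof.
move=> [mY [iY dY]] mB.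
(* Independence is stated for sets indexed by all of [nat], so [B] is extended by [setT]. *)
pose C (i : nat) : set T' := if insub i is Some k then B k else setT.
have mC i : measurable (C i).
  by rewrite /C; case: insubP => [k _ _|_]; [exact: mB|exact: measurableT].
have CE (k : 'I_M) : C k = B k by rewrite /C valK.
have -> : [set w | forall m : 'I_M, B m (Y m w)] =
    \bigcap_(i in [set i | i \in iota 0 M]) (Y i @^-1` C i).
  apply/seteqP; split => w /= h.
    move=> i /=; rewrite mem_iota /= => iM; have := h (Ordinal iM).
    by rewrite -CE.
  by move=> m; rewrite -CE; apply: (h m); rewrite /= mem_iota /=.
rewrite iY ?iota_uniq //.
rewrite -[M in iota 0 M]subn0 -/(index_iota 0 M) big_mkord.
by apply: eq_bigr => k _; rewrite dY // CE.
Qed.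

Lemma measurable_sum_le (R : realType) (d0 d1 : measure_display) (T : measurableType d0)
  (T' : measurableType d1) (X : nat -> T -> T') (g : T' -> R) (M : nat) (c : R) :
  (forall m, measurable_fun setT (X m)) -> measurable_fun setT g ->
  measurable [set w | \sum_(m < M) g (X m w) <= c].
Proof.
move=> mX mg; rewrite -[X in measurable X]setTI; apply: measurable_fun_le => //.
by apply: measurable_sum => m; exact: measurableT_comp.
Qed.

(* The tail probability is a finite sum over the vectors of levels, which [bigA_distr_bigA]
   factorizes after the exponential Markov bound. *)
Lemma chernoff_finite (R : realType) (d0 d1 : measure_display) (T : measurableType d0)
  (T' : measurableType d1) (P : probability T R) (X : nat -> T -> T') (V : finType)
  (lev : T' -> V) (g : V -> R) (M : nat) (lam s : R) :
  iid P X -> (forall v, measurable [set x | lev x = v]) -> 0 <= lam ->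
  measurable [set w | \sum_(m < M) g (lev (X m w)) <= s] /\
  (P [set w | (\sum_(m < M) g (lev (X m w)) <= s)%R] <=
   (expR (lam * s) * (\sum_v fine (P (X 0%N @^-1` [set x | lev x = v])) *
       expR (- (lam * g v))) ^+ M)%:E)%E.
Proof.
move=> iidX mlev lam0; have mX := iidX.1.
pose p v := fine (P (X 0%N @^-1` [set x | lev x = v])).
have mXl m v : measurable (X m @^-1` [set x | lev x = v]).
  by rewrite -[X in measurable X]setTI; apply: mX.
have pE v : P (X 0%N @^-1` [set x | lev x = v]) = (p v)%:E.
  by rewrite /p fineK // fin_num_measure.
have p0 v : 0 <= p v by apply: fine_ge0; exact: measure_ge0.
pose E (f : {ffun 'I_M -> V}) := [set w | forall m : 'I_M, lev (X m w) = f m].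
have mE f : measurable (E f).
  have -> : E f = \bigcap_(m in [set: 'I_M]) (X m @^-1` [set x | lev x = f m]).
    by apply/seteqP; split => w /= h m; [move=> _; exact: h|exact: (h m)].
  by apply: fin_bigcap_measurable.
have PE f : P (E f) = (\prod_(m < M) p (f m))%:E.
  rewrite /E (iid_prod (B := fun m => [set x | lev x = f m])) // -prodEFin.
  by apply: eq_bigr => m _; rewrite pE.
have -> : [set w | \sum_(m < M) g (lev (X m w)) <= s] =
    \big[setU/set0]_(f : {ffun 'I_M -> V} | \sum_(m < M) g (f m) <= s) E f.
  rewrite -bigcup_seq_cond; apply/seteqP; split => w /=.
    move=> h; exists [ffun m : 'I_M => lev (X m w)] => [|m]; last by rewrite ffunE.
    rewrite /= mem_index_enum /=; apply: le_trans h; apply: ler_sum => m _.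
    by rewrite ffunE.
  move=> [f /= /andP[_ h] Ef]; apply: le_trans h; apply: ler_sum => m _.
  by rewrite Ef.
split; first exact: bigsetU_measurable.
apply: (le_trans (measure_bigU_le _ _ _ mE)).
rewrite (eq_bigr (fun f : {ffun 'I_M -> V} => (\prod_(m < M) p (f m))%:E)); last first.
  by move=> f _; exact: PE.
rewrite sumEFin lee_fin.
(* Markov: an admissible vector has [expR (lam * (s - \sum_m g (f m))) >= 1], and all other vectors
   contribute nonnegative terms. *)
apply: (@le_trans _ _ (\sum_(f : {ffun 'I_M -> V})
    expR (lam * s) * \prod_(m < M) (p (f m) * expR (- (lam * g (f m)))))).
  rewrite big_mkcond /=; apply: ler_sum => f _.
  have h0 : 0 <= \prod_(m < M) p (f m) by apply: prodr_ge0 => m _; exact: p0.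
  rewrite big_split /= -expR_sum mulrCA -expRD.
  case: ifP => [hs|_]; last by rewrite mulr_ge0 // expR_ge0.
  apply: ler_peMr => //.
  rewrite -[leLHS]expR0 ler_expR sumrN -mulr_sumr -mulrBr mulr_ge0 //.
  by rewrite subr_ge0.
rewrite -mulr_sumr -(bigA_distr_bigA (fun (_ : 'I_M) v => p v * expR (- (lam * g v)))).
by rewrite big_const_ord iter_mulr_1.
Qed.

(* Rounding [g] down to multiples of [1/n] with [1/n <= t/4] leaves finitely many values,
   so independence of events suffices and the constant degrades only to 1/8. *)
Lemma bernstein_lower (R : realType) (d0 d1 : measure_display) (T : measurableType d0)
  (T' : measurableType d1) (P : probability T R) (X : nat -> T -> T')
  (g : T' -> R) (M : nat) (t : R) :
  iid P X -> measurable_fun setT g -> (forall x, 0 <= g x <= 1) -> 0 < t -> 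
  (P [set w | (\sum_(m < M) g (X m w) <=
     M%:R * (fine (\int[P]_w (g (X 0%N w))%:E) - t))%R] <=
   (expR (- (M%:R * t ^+ 2 / 8)))%:E)%E.
Proof.
move=> iidX mg g01 t0; have mX := iidX.1.
pose n := (Num.truncn (4 / t)).+1.
have n0 : 0 < n%:R :> R by rewrite ltr0n.
have nt : n%:R^-1 <= t / 4.
  rewrite -[leRHS]invrK invf_div lef_pV2 ?posrE ?divr_gt0 //.
  by apply: ltW; apply: truncnS_gt.
pose lev x : 'I_n.+1 := inord (Num.truncn (n%:R * g x)).
have ng0 x : 0 <= n%:R * g x by apply: mulr_ge0; [exact: ltW|case/andP: (g01 x)].
have ltn x : (Num.truncn (n%:R * g x) < n.+1)%N.
  have /andP[h _] := truncn_itv (ng0 x); rewrite ltnS -(ler_nat R); apply: (le_trans h).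
  by apply: ler_piMr; [exact: ltW|case/andP: (g01 x)].
have levE x : (lev x)%:R = (Num.truncn (n%:R * g x))%:R :> R.
  by rewrite /lev inordK.
pose gl (v : 'I_n.+1) : R := v%:R / n%:R.
have gl_le x : gl (lev x) <= g x.
  rewrite /gl ler_pdivrMr // levE [leRHS]mulrC; have /andP[] := truncn_itv (ng0 x); lra.
have gl_ge x : g x <= gl (lev x) + n%:R^-1.
  rewrite /gl -[X in _ + X]div1r -mulrDl ler_pdivlMr // levE natr1 [leLHS]mulrC.
  have /andP[] := truncn_itv (ng0 x); lra.
have gl1 v : 0 <= gl v <= 1.
  rewrite divr_ge0 //= ler_pdivrMr // mul1r ler_nat -ltnS; exact: ltn_ord.
have mlev v : measurable [set x | lev x = v].
  have -> : [set x | lev x = v] = g @^-1` `[v%:R / n%:R, v.+1%:R / n%:R[%classic.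
    apply/seteqP; split => x /=; rewrite in_itv /= ler_pdivrMr // ltr_pdivlMr // mulrC.
      by move=> <-; rewrite /lev inordK // truncn_itv.
    move=> h; apply: val_inj; rewrite /= inordK //.
    exact: truncn_def.
  by rewrite -[X in measurable X]setTI; apply: mg => //; exact: measurable_itv.
set mu := fine _.
pose p v := fine (P (X 0%N @^-1` [set x | lev x = v])).
have mXl v : measurable (X 0%N @^-1` [set x | lev x = v]).
  by rewrite -[X in measurable X]setTI; apply: mX.
have pE v : P (X 0%N @^-1` [set x | lev x = v]) = (p v)%:E.
  by rewrite /p fineK // fin_num_measure.
have p0 v : 0 <= p v by apply: fine_ge0; exact: measure_ge0.
have mgX : measurable_fun setT (fun w => g (X 0%N w)) by apply: measurableT_comp.
have UT : \big[setU/set0]_(v <- enum 'I_n.+1) (X 0%N @^-1` [set x | lev x = v]) = setT.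
  apply/seteqP; split => // w _; rewrite -bigcup_seq.
  by exists (lev (X 0%N w)) => //=; rewrite mem_enum.
have trU : trivIset [set` enum 'I_n.+1] (fun v => X 0%N @^-1` [set x | lev x = v]).
  by move=> i j _ _ [w [/= <- <-]].
have p1 : \sum_v p v = 1.
  apply: EFin_inj; rewrite -sumEFin -(probability_setT P) -UT -bigcup_seq.
  rewrite measure_fin_bigcup //.
  rewrite -fsbig_seq ?enum_uniq // big_enum /=.
  by apply: eq_bigr => v _; rewrite pE.
(* The integral is split over the level sets, on which [g] exceeds its rounded value by at most
   [1 / n]. *)
have mu_le : mu <= \sum_v p v * gl v + n%:R^-1.
  have h : (\int[P]_w (g (X 0%N w))%:E <= (\sum_v p v * gl v + n%:R^-1)%:E)%E.
    rewrite -UT ge0_integral_bigsetU ?enum_uniq //; last 2 first.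
    - by rewrite UT; apply/measurable_EFinP.
    - by move=> w _; rewrite lee_fin; case/andP: (g01 (X 0%N w)).
    have -> : \sum_v p v * gl v + n%:R^-1 = \sum_v (gl v + n%:R^-1) * p v.
      under [RHS]eq_bigr do rewrite mulrC mulrDr.
      by rewrite big_split /= -mulr_suml p1 mul1r.
    rewrite big_enum /= (eq_bigl xpredT) // -sumEFin.
    apply: lee_sum => v _; rewrite EFinM -pE -integral_cst //.
    apply: ge0_le_integral => //.
    - by move=> w _; rewrite lee_fin; case/andP: (g01 (X 0%N w)).
    - by apply: measurable_funTS; apply/measurable_EFinP.
    - by move=> w /= <-; rewrite lee_fin.
  have h0 : (0 <= \int[P]_w (g (X 0%N w))%:E)%E.
    by apply: integral_ge0 => w _; rewrite lee_fin; case/andP: (g01 (X 0%N w)).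
  rewrite -lee_fin /mu fineK // ge0_fin_numE //; exact: le_lt_trans h (ltry _).
have [mS1 PS1] := chernoff_finite gl M (M%:R * (mu - t)) iidX mlev (ltW (divr_gt0 t0 (ltr0n R 4))).
(* Rounding down decreases the sums, so the event only grows. *)
apply: (@le_trans _ _ (P [set w | (\sum_(m < M) gl (lev (X m w)) <= M%:R * (mu - t))%R])).
  apply: le_measure; rewrite ?inE //.
    exact: (measurable_sum_le _ _ mX mg).
  move=> w /=; apply: le_trans; apply: ler_sum => m _; exact: gl_le.
apply: (le_trans PS1); rewrite lee_fin.
(* With [lam = t / 4] and [1 / n <= t / 4] the exponent per sample is at most
   [lam * (t / 4 - t + lam) = - t ^ 2 / 8]. *)
set lam := t / 4%:R.
have lam0 : 0 <= lam by rewrite divr_ge0 // ltW.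
(* By [expRN_le] and [gl v <= 1] the average is at most [1 - lam * \sum_v p v * gl v + lam ^ 2];
   then [mu_le] and [1 + y <= expR y] apply. *)
have hs : \sum_v p v * expR (- (lam * gl v)) <= expR (- (lam * (mu - n%:R^-1)) + lam ^+ 2).
  apply: (le_trans _ (expR_ge1Dx _)).
  apply: (@le_trans _ _ (\sum_v (p v - lam * (p v * gl v) + lam ^+ 2 * p v))).
    apply: ler_sum => v _.
    have /andP[g0 g1] := gl1 v.
    have := expRN_le (mulr_ge0 lam0 g0) => /(ler_wpM2l (p0 v)) /le_trans; apply.
    have : p v * (lam * gl v) ^+ 2 <= p v * lam ^+ 2.
      apply: ler_wpM2l => //; rewrite exprMn ler_piMr ?sqr_ge0 // expr_le1 //.
    lra.
  rewrite big_split /= sumrB -!mulr_sumr p1.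
  have := ler_wpM2l lam0 mu_le; lra.
apply: (@le_trans _ _ (expR (lam * (M%:R * (mu - t))) *
    expR (- (lam * (mu - n%:R^-1)) + lam ^+ 2) ^+ M)).
  apply: ler_wpM2l; first exact: expR_ge0.
  apply: lerXn2r => //; rewrite nnegrE ?expR_ge0 //.
  by apply: sumr_ge0 => v _; apply: mulr_ge0; [exact: p0|exact: expR_ge0].
rewrite -expRM_natl -expRD ler_expR.
have M0 : 0 <= M%:R :> R by [].
have -> : - (M%:R * t ^+ 2 / 8) = M%:R * (lam * (t / 4 - t + lam)).
  by rewrite /lam; field.
have -> : lam * (M%:R * (mu - t)) + M%:R * (- (lam * (mu - n%:R^-1)) + lam ^+ 2) =
  M%:R * (lam * (n%:R^-1 - t + lam)) by ring.
by apply: ler_wpM2l => //; apply: ler_wpM2l => //; lra.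
Qed.

(** * Measurability *)

Lemma measurable_par (R : realType) (D n : nat) :
  measurable_fun setT (fun th : D.-tuple R => par th n).
Proof.
case: (ltnP n D) => h.
  have -> : (fun th : D.-tuple R => par th n) = (fun th => tnth th (Ordinal h)).
    by apply/funext => th; rewrite /par (tnth_nth 0).
  exact: measurable_tnth.
have -> : (fun th : D.-tuple R => par th n) = cst 0.
  by apply/funext => th; rewrite /par nth_default // size_tuple.
exact: measurable_cst.
Qed.

Lemma measurable_affine (R : realType) (d0 : measure_display) (T : measurableType d0)
  (D r s k : nat) (th : T -> D.-tuple R) (x : T -> 'I_s -> R) (i : 'I_r) :
  measurable_fun setT th -> (forall j, measurable_fun setT (fun t => x t j)) ->
  measurable_fun setT (fun t => affine k (th t) (x t) i).
Proof.
move=> mth mx; rewrite /affine.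
have mp n : measurable_fun setT (fun t => par (th t) n).
  exact: (measurableT_comp (measurable_par n) mth).
apply: (measurable_funD _ (mp _)).
by apply: measurable_sum => j; exact: (measurable_funM (mp _) (mx j)).
Qed.

Lemma measurable_realization (R : realType) (d0 : measure_display) (T : measurableType d0)
  (D d tau : nat) (th : T -> D.-tuple R) (x : T -> d.-tuple R) :
  measurable_fun setT th -> measurable_fun setT x ->
  measurable_fun setT (fun t => realization tau (th t) (x t)).
Proof.
move=> mth mx.
have mrelu (f : T -> R) : measurable_fun setT f ->
    measurable_fun setT (fun t => Num.max (f t) 0).
  by move=> mf; apply: measurable_maxr.
have mh j (i : 'I_tau) : measurable_fun setT
    (fun t => hidden (th t) (fun k => tnth (x t) k) j i).
  elim: j i => [|j IH] i; apply: mrelu; apply: measurable_affine => // k.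
  exact: (measurableT_comp (measurable_tnth k) mx).
apply: (measurable_minr (measurable_cst _)).
apply: (measurable_maxr (measurable_cst _)).
by apply: measurable_affine.
Qed.

Lemma measurable_find (d0 : measure_display) (T : measurableType d0)
  (p : nat -> T -> bool) (s : seq nat) :
  (forall k, measurable_fun setT (p k)) ->
  measurable_fun setT (fun w => find (fun k => p k w) s).
Proof.
move=> mp; elim: s => [|k s IH] /=; first exact: measurable_cst.
apply: measurable_fun_ifT => //.
by apply: (measurableT_comp (f := S)).
Qed.

Lemma measurable_argmin (R : realType) (d0 : measure_display) (T : measurableType d0)
  (E : nat -> T -> R) (K : nat) :
  (forall k, measurable_fun setT (E k)) ->
  measurable_fun setT (fun w =>
    find (fun k => [forall j : 'I_K, E k w <= E j w]) (iota 0 K)).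
Proof.
move=> mE; apply: measurable_find => k.
have -> : (fun w => [forall j : 'I_K, E k w <= E j w]) =
    (fun w => \big[andb/true]_(j < K) (E k w <= E j w)).
  apply/funext => w; rewrite big_andE; apply/forallP/forallP => h j; exact: h.
elim: (index_enum _) => [|j l IH].
  by rewrite (_ : (fun _ => _) = cst true) //; apply/funext => w; rewrite big_nil.
rewrite (_ : (fun _ => _) = (fun w => (E k w <= E j w) &&
    \big[andb/true]_(i <- l) (E k w <= E i w))); last first.
  by apply/funext => w; rewrite big_cons.
by apply: measurable_and => //; exact: measurable_fun_ler.
Qed.

Lemma measurable_cube (R : realType) (d : nat) (a b : R) :
  measurable (cube a b : set (d.-tuple R)).
Proof.
have -> : cube a b = \bigcap_(i in [set: 'I_d]) 
    ((fun x : d.-tuple R => tnth x i) @^-1` `[a, b]%classic).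
  apply/seteqP; split => x /= h i; first by move=> _; rewrite /= in_itv /=; exact: h.
  by have := h i I; rewrite /= in_itv.
apply: fin_bigcap_measurable => // i _.
rewrite -[X in measurable X]setTI; apply: measurable_tnth => //; exact: measurable_itv.
Qed.

(** * Approximation by an explicit network *)

(* An affine layer stores its [r x s] weights row by row, followed by its [r] biases. *)
Definition flat (R : Type) (r s : nat) (W : nat -> nat -> R) (b : nat -> R) (t : nat) : R :=
  if (t < r * s)%N then W (t %/ s)%N (t %% s)%N else b (t - r * s)%N.

Lemma flatW (R : Type) (r s : nat) (W : nat -> nat -> R) (b : nat -> R) (i j : nat) :
  (i < r)%N -> (j < s)%N -> flat r s W b (i * s + j) = W i j.
Proof.
move=> ir js; rewrite /flat ifT; last by nia.
by rewrite divnMDl ?(leq_trans _ js) // divn_small // addn0 modnMDl modn_small.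
Qed.

Lemma flatb (R : Type) (r s : nat) (W : nat -> nat -> R) (b : nat -> R) (i : nat) :
  flat r s W b (r * s + i) = b i.
Proof. by rewrite /flat ifF ?addKn //; lia. Qed.

Section ExplicitParameters.

(** * Parameter vectors of networks with prescribed weights and biases *)

Variables (R : realType) (d tau D : nat).
Variables (W0 : nat -> nat -> R) (b0 : nat -> R) (Wh : nat -> nat -> nat -> R)
  (bh : nat -> nat -> R) (Wo : nat -> R) (bo : R).

(** The hidden blocks all have length [q], so quotient and remainder by [q] give the layer and the
    offset within it. Entries past the end of the network receive the value [bo], which keeps the
    whole vector in the cube. *)
Definition net_par (t : nat) : R :=
  let q := (tau * (tau + 1))%N in
  let t1 := (t - tau * (d + 1))%N in
  if (t < tau * (d + 1))%N then flat tau d W0 b0 t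
  else if (t1 < (tau - 3) * q)%N then flat tau tau (Wh (t1 %/ q)) (bh (t1 %/ q)) (t1 %% q)
  else flat 1 tau (fun=> Wo) (fun=> bo) (t1 - (tau - 3) * q).

Definition net_tuple : D.-tuple R := [tuple net_par i | i < D].

Lemma par_net_tuple (t : nat) : (t < D)%N -> par net_tuple t = net_par t.
Proof.
by move=> tD; rewrite /par -(tnth_nth 0 net_tuple (Ordinal tD)) tnth_mktuple.
Qed.

Hypothesis leD : (tau * (d + 1) + (tau - 3) * tau * (tau + 1) + tau + 1 <= D)%N.

Lemma affine_net_in (x : 'I_d -> R) (i : 'I_tau) :
  affine 0 net_tuple x i = \sum_(j < d) W0 i j * x j + b0 i.
Proof.
have it := ltn_ord i.
have pE t : (t < tau * (d + 1))%N -> par net_tuple t = flat tau d W0 b0 t.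
  by move=> h; rewrite par_net_tuple ?/net_par ?h //; lia.
rewrite /affine !add0n; congr (_ + _).
  apply: eq_bigr => j _; have jd := ltn_ord j.
  by rewrite pE ?flatW //; nia.
by rewrite pE ?flatb //; nia.
Qed.

Lemma affine_net_hidden (l : nat) (x : 'I_tau -> R) (i : 'I_tau) : (l < tau - 3)%N ->
  affine (tau * (d + 1) + l * (tau * (tau + 1))) net_tuple x i =
  \sum_(j < tau) Wh l i j * x j + bh l i.
Proof.
move=> lt; have it := ltn_ord i.
have pE u : (u < tau * (tau + 1))%N ->
    par net_tuple (tau * (d + 1) + l * (tau * (tau + 1)) + u) =
    flat tau tau (Wh l) (bh l) u.
  move=> h; set q := (tau * (tau + 1))%N in h *.
  have h2 : (l * q + u < (tau - 3) * q)%N by nia.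
  rewrite par_net_tuple; last by rewrite /q in h2 *; nia.
  rewrite /net_par -addnA ifF; last by lia.
  rewrite addKn -/q h2 divnMDl; last by lia.
  by rewrite divn_small // addn0 modnMDl modn_small.
rewrite /affine; congr (_ + _).
  apply: eq_bigr => j _; have jd := ltn_ord j.
  by rewrite -[in LHS]addnA pE ?flatW //; nia.
by rewrite -[in LHS]addnA pE ?flatb //; nia.
Qed.

Lemma affine_net_out (x : 'I_tau -> R) (i : 'I_1) :
  affine (tau * (d + 1) + (tau - 3) * (tau * (tau + 1))) net_tuple x i =
  \sum_(j < tau) Wo j * x j + bo.
Proof.
have pE u : (u < tau + 1)%N ->
    par net_tuple (tau * (d + 1) + (tau - 3) * (tau * (tau + 1)) + u) =
    flat 1 tau (fun=> Wo) (fun=> bo) u.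
  move=> h; rewrite par_net_tuple; last by lia.
  rewrite /net_par -addnA ifF; last by lia.
  by rewrite addKn ifF ?addKn //; lia.
rewrite /affine ord1; congr (_ + _).
  apply: eq_bigr => j _; have jd := ltn_ord j.
  by rewrite -[in LHS]addnA pE ?flatW //= ?mul0n; lia.
by rewrite -[in LHS]addnA pE ?flatb //= ?mul1n; lia.
Qed.

Lemma net_tuple_cube (B : R) :
  (forall i j, `|W0 i j| <= B) -> (forall i, `|b0 i| <= B) ->
  (forall l i j, `|Wh l i j| <= B) -> (forall l i, `|bh l i| <= B) ->
  (forall i, `|Wo i| <= B) -> `|bo| <= B ->
  cube (- B) B net_tuple.
Proof.
move=> h1 h2 h3 h4 h5 h6 i; rewrite tnth_mktuple -ler_norml /net_par /flat.
by do !case: ifP.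
Qed.

End ExplicitParameters.

Section Decode.
Variables (R : realType) (U : finType) (tau : nat).

(* Neurons are named by the elements of [U]; the neurons with index at least [#|U|] are idle. *)
Definition decode (p : nat) : option U :=
  if insub p : option 'I_#|U| is Some o then Some (enum_val o) else None.

(** Idle neurons contribute 0, so the sum over a layer turns into a sum over neuron names as soon as
    the layer is wide enough. *)
Lemma sum_decode (F : U -> R) : (#|U| <= tau)%N ->
  \sum_(p < tau) (if decode p is Some u then F u else 0) = \sum_u F u.
Proof.
move=> hU; rewrite [RHS](reindex_onto enum_val enum_rank) /=; last first.
  by move=> u _; rewrite enum_rankK.
rewrite [RHS](eq_big xpredT (fun o : 'I_#|U| => if decode o is Some u then F u else 0)).
- rewrite (big_ord_widen _ (fun p => if decode p is Some u then F u else 0) hU).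
  rewrite [RHS]big_mkcond; apply: eq_bigr => p _.
  rewrite /decode; case: (insubP _ (p : nat)) => [k pk _|npo]; first by rewrite pk.
  by rewrite (negPf npo).
- by move=> o; rewrite enum_valK eqxx.
- by move=> o _; rewrite /decode valK.
Qed.
End Decode.

(** * A network that computes a running maximum of cones *)

Section MaxNetwork.
Variables (R : realType) (d n tau D : nat) (L B : R).
Variables (g : 'I_n -> R) (q : nat -> {ffun 'I_d -> 'I_n}) (v : nat -> R).

(* [inl (i, j, s)] carries [relu (+/- (x_i - g j))] (sign [-] for [s = true]) through all layers;
   [inr true] and [inr false] hold the previous running maximum and its last increment. *)
Let U : finType := ('I_d * 'I_n * bool + bool)%type.

Definition in_weight (p k : nat) : R :=
  if decode U p is Some (inl (i, _, s)) then if (i == k :> nat) then (-1) ^+ s else 0 else 0.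

Definition in_bias (p : nat) : R :=
  if decode U p is Some (inl (_, j, s)) then - ((-1) ^+ s * g j) else 0.

(** Row [inl w] copies a ramp, which [relu] leaves unchanged. Row [inr true] adds the two
    accumulator neurons into the current maximum s. Row [inr false], with bias [v l], produces
    [cone l - s]: the two ramps of opposite sign at [(i, q l i)] both get weight [- L] and add up to
    the distance in coordinate [i]. *)
Definition unit_weight (l : nat) (u u' : U) : R :=
  match u, u' with
  | inl w, inl w' => (w == w')%:R
  | inl _, inr _ => 0
  | inr true, inr _ => 1
  | inr true, inl _ => 0
  | inr false, inr _ => -1
  | inr false, inl (i, j, _) => if j == q l i then - L else 0
  end.

Definition hid_weight (l p p' : nat) : R :=
  if decode U p is Some u then
    if decode U p' is Some u' then unit_weight l u u' else 0
  else 0.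

Definition hid_bias (l p : nat) : R :=
  if decode U p is Some (inr false) then v l else 0.

Definition out_weight (p : nat) : R := if decode U p is Some (inr _) then 1 else 0.

Definition max_net : D.-tuple R :=
  net_tuple d tau D in_weight in_bias hid_weight hid_bias out_weight 0.

Hypothesis leD : (tau * (d + 1) + (tau - 3) * tau * (tau + 1) + tau + 1 <= D)%N.
Hypothesis leU : (2 * d * n + 2 <= tau)%N.

Let cardU : (#|U| <= tau)%N.
Proof.
by rewrite card_sum !card_prod !card_ord card_bool; nia.
Qed.

Variable x : d.-tuple R.

Definition ramp (w : 'I_d * 'I_n * bool) : R :=
  Num.max ((-1) ^+ w.2 * tnth x w.1.1 - (-1) ^+ w.2 * g w.1.2) 0.

Definition cone (l : nat) : R := v l - L * \sum_(i < d) `|tnth x i - g (q l i)|.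

(** The start at 0 keeps the maximum nonnegative, so it passes through [relu]; it never overshoots a
    nonnegative target. *)
Fixpoint run_max (l : nat) : R :=
  if l is l'.+1 then Num.max (run_max l') (cone l') else 0.

Lemma run_max_ge0 (l : nat) : 0 <= run_max l.
Proof. by elim: l => //= l IH; rewrite le_max IH. Qed.

(** The maximum is kept as a sum of two neurons because its update [s + relu (cone - s)] is affine
    only after the activation: the addition is postponed to the next layer. *)
Definition state (l : nat) (u : U) : R :=
  match u with
  | inl w => ramp w
  | inr true => if l is l'.+1 then run_max l' else 0
  | inr false => if l is l'.+1 then run_max l - run_max l' else 0
  end.

Lemma ramp_sum (i : 'I_d) (j : 'I_n) :
  ramp (i, j, true) + ramp (i, j, false) = `|tnth x i - g j|.
Proof.
rewrite /ramp /= expr0 expr1 !mul1r !mulN1r opprK.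
have -> : - tnth x i + g j = - (tnth x i - g j) by ring.
case: (ger0P (tnth x i - g j)) => h.
  by rewrite max_r ?oppr_le0 // add0r.
by rewrite max_l ?oppr_ge0 ?ltW // addr0.
Qed.

Lemma cone_sum (l : nat) :
  \sum_(w : 'I_d * 'I_n * bool) unit_weight l (inr false) (inl w) * ramp w =
  - (L * \sum_(i < d) `|tnth x i - g (q l i)|).
Proof.
transitivity (\sum_(i < d) \sum_(j < n) \sum_(s : bool)
    (if j == q l i then - L else 0) * ramp (i, j, s)).
  by rewrite pair_bigA /= pair_bigA /=; apply: eq_bigr => -[[i j] s] _.
rewrite mulr_sumr -sumrN; apply: eq_bigr => i _.
rewrite (bigD1 (q l i)) //= [X in _ + X]big1 ?addr0; last first.
  by move=> j /negPf hj; rewrite hj big1 // => s _; rewrite mul0r.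
by rewrite eqxx big_bool /= -mulrDr ramp_sum mulNr.
Qed.

Lemma hidden_max_net (l : nat) (p : 'I_tau) : (l <= tau - 3)%N ->
  hidden max_net (fun k => tnth x k) l p =
  if decode U p is Some u then state l u else 0.
Proof.
elim: l p => [|l IH] p hl; rewrite ?hidden0E ?hiddenSE /relu.
  rewrite /max_net affine_net_in // /in_weight /in_bias.
  case: (decode U p) => [[[[i j] s]|s]|]; rewrite /state.
  - rewrite (bigD1 i) //= eqxx big1 ?addr0 // => k ki.
    by rewrite ifF ?mul0r //; apply/negbTE; rewrite eq_sym.
  - by rewrite big1 ?addr0 ?maxxx; [case: s|move=> k _; rewrite mul0r].
  - by rewrite big1 ?addr0 ?maxxx // => k _; rewrite mul0r.
rewrite /max_net affine_net_hidden // -/max_net.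
have IH' (k : 'I_tau) : hidden max_net (fun k => tnth x k) l k =
  if decode U k is Some u then state l u else 0 by apply: IH; exact: ltnW.
under eq_bigr do rewrite IH'.
rewrite /hid_weight /hid_bias; case Ep: (decode U p) => [u|]; last first.
  by rewrite big1 ?addr0 ?maxxx // => k _; rewrite mul0r.
rewrite (eq_bigr (fun k : 'I_tau => if decode U k is Some u' then
    unit_weight l u u' * state l u' else 0)); last first.
  by move=> k _; case: (decode U k) => [u'|]; rewrite ?mul0r.
rewrite (sum_decode (fun u' => unit_weight l u u' * state l u') cardU).
rewrite big_sumType big_bool /=.
(* The current maximum s is thus a linear function of the layer, and the new increment is
   [relu (cone l - s) = max s (cone l) - s]. *)
have sumE : state l (inr true) + state l (inr false) = run_max l.
  by rewrite /state; case: l {hl IH IH'} => [|l]; rewrite ?addr0 // addrC subrK.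
case: u {Ep} => [w|[]] /=.
- rewrite (bigD1 w) //= eqxx big1 => [|w' ww']; last first.
    by rewrite eq_sym (negPf ww') mul0r.
  by rewrite !mul0r !addr0 mul1r max_l // le_max lexx orbT.
- rewrite big1 => [|w _]; last by rewrite mul0r.
  by rewrite !mul1r add0r addr0 sumE max_l // run_max_ge0.
- rewrite cone_sum !mulN1r -opprD sumE.
  rewrite -/(cone l); case: (leP (run_max l) (cone l)) => h.
    by rewrite max_l; rewrite /cone in h *; lra.
  by rewrite subrr max_r //; rewrite /cone in h; lra.
Qed.

Lemma realization_max_net : (2 < tau)%N -> realization tau max_net x = clip (run_max (tau - 3)).
Proof.
move=> t3; rewrite /realization; congr clip.
rewrite /max_net affine_net_out // -/max_net addr0.
under eq_bigr do rewrite hidden_max_net //.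
rewrite /out_weight.
rewrite (eq_bigr (fun k : 'I_tau => if decode U k is Some u then
    (if u is inr _ then 1 else 0) * state (tau - 3) u else 0)); last first.
  by move=> k _; case: (decode U k) => [[w|s]|]; rewrite ?mul0r.
rewrite (sum_decode (fun u : U => (if u is inr _ then 1 else 0) * state (tau - 3) u) cardU).
rewrite big_sumType big_bool /= big1 => [|w _]; last by rewrite mul0r.
rewrite !mul1r add0r; case: (tau - 3)%N => [|l]; rewrite ?addr0 //.
by rewrite addrC subrK.
Qed.

Lemma run_max_le (y : R) (l : nat) : 0 <= y -> (forall k, cone k <= y) -> run_max l <= y.
Proof. by move=> y0 h; elim: l => //= l IH; rewrite ge_max IH h. Qed.

Lemma run_max_ge (l k : nat) : (k < l)%N -> cone k <= run_max l.
Proof.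
elim: l => //= l IH; rewrite ltnS leq_eqVlt le_max => /orP[/eqP ->|/IH ->//].
by rewrite lexx orbT.
Qed.

(** Every entry is 0, 1, -1, [- L], some [g j] up to sign, or some [v l]. *)
Lemma max_net_cube : 1 <= B -> 0 <= L <= B -> (forall j, `|g j| <= B) ->
  (forall l, `|v l| <= B) -> cube (- B) B max_net.
Proof.
move=> B1 /andP[L0 LB] gB vB; have B0 : 0 <= B by lra.
apply: net_tuple_cube.
- move=> p k; rewrite /in_weight; case: (decode U p) => [[[[i j] s]|s]|]; rewrite ?normr0 //.
  by case: ifP => _; rewrite ?normr0 // normrX normrN1 expr1n.
- move=> p; rewrite /in_bias; case: (decode U p) => [[[[i j] s]|s]|]; rewrite ?normr0 //.
  by rewrite normrN normrM normrX normrN1 expr1n mul1r.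
- move=> l p p'; rewrite /hid_weight; case: (decode U p) => [u|]; rewrite ?normr0 //.
  case: (decode U p') => [u'|]; rewrite ?normr0 //.
  case: u u' => [w|[]] [[[i j] s]|s'] /=; rewrite ?normr0 ?normrN ?normr1 //.
  + by case: eqP; rewrite ?normr0 ?normr1.
  + by case: ifP => _; rewrite ?normr0 // normrN ger0_norm.
- move=> l p; rewrite /hid_bias; case: (decode U p) => [[w|[]]|]; rewrite ?normr0 //.
- move=> p; rewrite /out_weight; case: (decode U p) => [[w|s]|]; rewrite ?normr0 ?normr1 //.
- by rewrite normr0.
Qed.

End MaxNetwork.

(** Makes [phi] Lipschitz for the l1 distance too, which a ReLU layer can compute exactly; hence the
    cones are built from that distance. *)
Lemma eucl_dist_le (R : realType) (n : nat) (x y : n.-tuple R) :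
  eucl_dist x y <= \sum_(i < n) `|tnth x i - tnth y i|.
Proof.
rewrite /eucl_dist; set s := \sum_(i < n) `|_|.
have s0 : 0 <= s by apply: sumr_ge0.
rewrite -[leRHS]ger0_norm // -sqrtr_sqr ler_wsqrtr // expr2 {1}/s mulr_suml.
apply: ler_sum => i _; rewrite -real_normK ?num_real // expr2 ler_wpM2l //.
by rewrite /s (bigD1 i) //= lerDl sumr_ge0.
Qed.

(** Centers of [n] equal cells. They serve twice: for the grid points in the input cube and for the
    covering of the parameter cube. *)
Definition midpoint (R : realType) (a b : R) (n : nat) (j : nat) : R :=
  a + (b - a) * (j%:R + 2^-1) / n%:R.

Lemma midpoint_itv (R : realType) (a b : R) (n : nat) (j : 'I_n) : a < b ->
  a <= midpoint a b n j <= b.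
Proof.
move=> ab; have n0 : 0 < n%:R :> R by rewrite ltr0n (leq_trans _ (ltn_ord j)).
have jn : j%:R + 1 <= n%:R :> R by rewrite natr1 ler_nat.
have j0 : 0 <= j%:R :> R by [].
have ba : 0 <= b - a by lra.
rewrite /midpoint lerDl divr_ge0 ?mulr_ge0 //=; try lra.
rewrite -lerBrDl ler_pdivrMr //; apply: ler_wpM2l => //; lra.
Qed.

Lemma midpoint_near (R : realType) (a b x : R) (n : nat) : (0 < n)%N -> a < b ->
  a <= x <= b -> exists j : 'I_n, `|x - midpoint a b n j| <= (b - a) / (2 * n%:R).
Proof.
move=> n0 ab /andP[ax xb]; have nR : 0 < n%:R :> R by rewrite ltr0n.
have ba : 0 < b - a by lra.
pose y := n%:R * (x - a) / (b - a).
have y0 : 0 <= y by rewrite divr_ge0 ?mulr_ge0 ?subr_ge0 ?(ltW ab).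
have yn : y <= n%:R by rewrite ler_pdivrMr // ler_wpM2l //; lra.
have /andP[t1 t2] := truncn_itv y0.
(* The index is capped at [n.-1] because the right end point [x = b] has [y = n]. *)
have kn : (minn (Num.truncn y) n.-1 < n)%N.
  by rewrite (leq_ltn_trans (geq_minr _ _)) // ltn_predL.
exists (Ordinal kn) => /=; set k := minn _ _.
have ky : k%:R <= y by apply: le_trans t1; rewrite ler_nat geq_minl.
have yk : y <= k%:R + 1.
  rewrite natr1 /k; case: (leqP (Num.truncn y) n.-1) => h; first exact: ltW.
  by rewrite prednK.
have -> : x - midpoint a b n k = (y - k%:R - 2^-1) * ((b - a) / n%:R).
  by rewrite /midpoint /y; field; rewrite !gt_eqF.
have q0 : 0 <= (b - a) / n%:R by rewrite divr_ge0 // ltW.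
rewrite normrM [X in _ * X]ger0_norm //.
have -> : (b - a) / (2 * n%:R) = 2^-1 * ((b - a) / n%:R) by field; rewrite gt_eqF.
by apply: ler_wpM2r => //; rewrite ler_norml; apply/andP; split; lra.
Qed.

(** By the Lipschitz condition every cone lies below [phi], hence so does their maximum. The cone at
    the midpoint nearest to [x] loses at most [L] times the l1 distance through its slope and as
    much again through the change of [phi], and that distance is at most [d * (b - a) / (2 * n)]. *)
Lemma network_approximation (R : realType) (d n tau D : nat) (L a b B : R)
  (phi : d.-tuple R -> R) :
  (0 < n)%N -> (2 * d * n + 2 <= tau)%N -> (n ^ d <= tau - 3)%N ->
  (tau * (d + 1) + (tau - 3) * tau * (tau + 1) + tau + 1 <= D)%N ->
  a < b -> 1 <= B -> 0 <= L <= B -> `|a| <= B -> `|b| <= B ->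
  (forall x, cube a b x -> 0 <= phi x <= 1) ->
  (forall x y, cube a b x -> cube a b y -> `|phi x - phi y| <= L * eucl_dist x y) ->
  exists2 th : D.-tuple R, cube (- B) B th &
    forall x, cube a b x -> `|realization tau th x - phi x| <= L * d%:R * (b - a) / n%:R.
Proof.
move=> n0 leU leN leD ab B1 LB aB bB phi01 philip.
have [L0 _] := andP LB.
have nd0 : (0 < n ^ d)%N by rewrite expn_gt0 n0.
have t3 : (2 < tau)%N by clear leU leD; lia.
(* Beyond the enumeration [nth] returns [f0], which is a grid point again, so surplus layers only
   repeat a cone that lies below [phi]. *)
pose f0 : {ffun 'I_d -> 'I_n} := [ffun=> Ordinal n0].
pose q l := nth f0 (enum {ffun 'I_d -> 'I_n}) l.
pose g (j : 'I_n) := midpoint a b n j.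
pose pt (f : {ffun 'I_d -> 'I_n}) := [tuple g (f i) | i < d].
have ptE f i : tnth (pt f) i = g (f i) by rewrite tnth_mktuple.
have cpt f : cube a b (pt f) by move=> i; rewrite ptE; exact: midpoint_itv.
pose v l := phi (pt (q l)).
exists (max_net tau D L g q v).
  apply: max_net_cube => // [j|l].
    have := midpoint_itv j ab; rewrite -/(g j).
    by move: aB bB; rewrite !ler_norml => /andP[? ?] /andP[? ?] /andP[? ?]; apply/andP; split; lra.
  by have /andP[? ?] := phi01 _ (cpt (q l)); rewrite /v ger0_norm //; lra.
move=> x cx; rewrite realization_max_net //.
have /andP[p0 p1] := phi01 _ cx.
have clipphi : phi x = clip (phi x) by rewrite /clip max_r // min_r.
rewrite [X in _ - X]clipphi; apply: (le_trans (clip_lip _ _)).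
have lip f : `|phi x - phi (pt f)| <= L * \sum_(i < d) `|tnth x i - g (f i)|.
  apply: (le_trans (philip _ _ cx (cpt f))); apply: ler_wpM2l => //.
  by apply: (le_trans (eucl_dist_le _ _)); apply: ler_sum => i _; rewrite ptE.
have cone_le l : cone L g q v x l <= phi x.
  by have := lip (q l); rewrite ler_norml /cone /v => /andP[h _]; move: h; lra.
have le1 : run_max L g q v x (tau - 3) <= phi x by apply: run_max_le.
have near i := midpoint_near n0 ab (cx i).
have [f hf] : exists f : {ffun 'I_d -> 'I_n},
    forall i, `|tnth x i - g (f i)| <= (b - a) / (2 * n%:R).
  exists [ffun i => sval (cid (near i))] => i; rewrite ffunE; exact: (svalP (cid (near i))).
(* Each of the [tau - 3] later hidden layers treats one cone, which suffices for all [n ^ d] grid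
   points. *)
have hl : (index f (enum {ffun 'I_d -> 'I_n}) < tau - 3)%N.
  apply: leq_trans leN; rewrite -[X in (_ < X ^ _)%N]card_ord -[X in (_ < _ ^ X)%N]card_ord.
  by rewrite -card_ffun cardE index_mem mem_enum.
have qf : q (index f (enum {ffun 'I_d -> 'I_n})) = f by rewrite /q nth_index // mem_enum.
have := run_max_ge L g q v x hl; rewrite /cone /v qf => hge.
have sumf : \sum_(i < d) `|tnth x i - g (f i)| <= d%:R * ((b - a) / (2 * n%:R)).
  rewrite mulr_natl -[X in _ *+ X]card_ord -sumr_const; apply: ler_sum => i _; exact: hf.
have := ler_wpM2l L0 sumf.
have -> : L * (d%:R * ((b - a) / (2 * n%:R))) = (L * d%:R * (b - a) / n%:R) / 2.
  by field; rewrite pnatr_eq0 -lt0n.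
have := ler_norm (phi x - phi (pt f)); have := lip f => l1 l2 h.
rewrite ler0_norm; last by rewrite subr_le0.
move: (\sum_(i < d) _) l1 hge h => S; clear -le1 l2; lra.
Qed.

(** * Random search and the error decomposition *)

(** The box has [th] as a corner and extends towards the origin in every coordinate. By [del <= r]
    it stays in the cube even if [th] lies on the boundary, so its probability is exact. *)
Lemma uniform_box (R : realType) (d0 : measure_display) (T : measurableType d0)
  (P : probability T R) (D : nat) (r del : R) (Z : T -> D.-tuple R) (th : D.-tuple R) :
  0 < del <= r -> uniform_on_cube r P Z -> cube (- r) r th ->
  exists B : set (D.-tuple R), [/\ measurable B,
    P (Z @^-1` B) = ((del / (2 * r)) ^+ D)%:E &
    forall t, B t -> forall i, `|tnth t i - tnth th i| <= del].
Proof.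
move=> /andP[del0 delr] uZ cth.
pose J (i : 'I_D) : interval R := if tnth th i <= 0 then `[tnth th i, tnth th i + del]
  else `[tnth th i - del, tnth th i].
pose I i : set R := [set` J i].
have mI i : measurable (I i) by exact: measurable_itv.
exists [set t | forall i, I i (tnth t i)]; split.
- have -> : [set t : D.-tuple R | forall i, I i (tnth t i)] =
      \bigcap_(i in [set: 'I_D]) ((fun t : D.-tuple R => tnth t i) @^-1` I i).
    by apply/seteqP; split => t /= h i; [move=> _; exact: h|exact: h].
  apply: fin_bigcap_measurable => // i _.
  by rewrite -[X in measurable X]setTI; apply: measurable_tnth.
- rewrite uZ // (eq_bigr (fun=> (del / (2 * r))%:E)); last first.
    move=> i _; have /andP[c1 c2] := cth i.
    have -> : I i `&` `[(- r)%R, r]%classic = I i.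
      apply/setIidl => y; rewrite /I /J /= in_itv /=.
      by case: (leP (tnth th i) 0) => hi; rewrite !in_itv /= => /andP[y1 y2];
        apply/andP; split; lra.
    rewrite EFinM; congr (_ * _)%E; rewrite /I lebesgue_measure_itv /J.
    case: (leP (tnth th i) 0) => _ /=; rewrite lte_fin ifT ?ltrBlDr ?ltrDl //.
    + by rewrite -EFinB; congr (_%:E); ring.
    + by rewrite -EFinB; congr (_%:E); ring.
  by rewrite prodEFin big_const_ord iter_mulr_1.
- move=> t h i; have := h i; rewrite /I /J /=.
  by case: (leP (tnth th i) 0) => _; rewrite in_itv /= => /andP[y1 y2];
    rewrite ler_norml; apply/andP; split; lra.
Qed.

(** The exceptional event is that all [K] samples miss the box of [uniform_box]; by independence its
    probability is [(1 - p) ^ K <= expR (- K * p)]. *)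
Lemma random_search (R : realType) (d0 : measure_display) (T : measurableType d0)
  (P : probability T R) (D K : nat) (r del : R) (Y : nat -> T -> D.-tuple R)
  (th : D.-tuple R) :
  0 < del <= r -> iid P Y -> uniform_on_cube r P (Y 0%N) -> cube (- r) r th ->
  exists A : set T, [/\ measurable A,
    (P A <= (expR (- (K%:R * (del / (2 * r)) ^+ D)))%:E)%E &
    forall w, ~ A w -> exists2 k, (k < K)%N &
      forall i, `|tnth (Y k w) i - tnth th i| <= del].
Proof.
move=> hdel iidY uY cth; have mY := iidY.1.
have [B [mB PB hB]] := uniform_box hdel uY cth.
set p := (del / (2 * r)) ^+ D in PB *.
have p1 : p <= 1.
  rewrite -lee_fin -PB; apply: probability_le1.
  by rewrite -[X in measurable X]setTI; apply: mY.
exists [set w | forall k : 'I_K, (~` B) (Y k w)]; split.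
- have -> : [set w | forall k : 'I_K, (~` B) (Y k w)] =
      \bigcap_(k in [set: 'I_K]) (Y k @^-1` (~` B)).
    by apply/seteqP; split => t /= h i; [move=> _; exact: h|exact: (h i I)].
  apply: fin_bigcap_measurable => // k _.
  by rewrite -[X in measurable X]setTI; apply: mY => //; exact: measurableC.
- rewrite (iid_prod (B := fun=> ~` B)) //; last by move=> _; exact: measurableC.
  have -> : P (Y 0%N @^-1` (~` B)) = (1 - p)%:E.
    rewrite preimage_setC probability_setC ?PB //.
    by rewrite -[X in measurable X]setTI; apply: mY.
  rewrite prodEFin big_const_ord iter_mulr_1 lee_fin -mulrN expRM_natl.
  apply: lerXn2r; rewrite ?nnegrE ?expR_ge0 ?subr_ge0 //.
  exact: expR_ge1Dx.
- move=> w /existsNP[k /contrapT hk]; exists k => // i; exact: hB.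
Qed.

(* [phi] is a uniform limit of network realizations on the cube, and those are measurable. *)
Lemma measurable_lipschitz_cube (R : realType) (d : nat) (L a b : R)
  (phi : d.-tuple R -> R) : a < b -> 0 <= L ->
  (forall x, cube a b x -> 0 <= phi x <= 1) ->
  (forall x y, cube a b x -> cube a b y -> `|phi x - phi y| <= L * eucl_dist x y) ->
  measurable_fun (cube a b) phi.
Proof.
move=> ab L0 phi01 philip.
(* Any bound and any architecture admissible for the approximation will do; both the width and the
   depth grow with [n]. *)
pose B := 1 + L + `|a| + `|b|.
have a0 := normr_ge0 a; have b0 := normr_ge0 b.
pose tau n := (2 * d * n + 2 + n ^ d + 3)%N.
pose D n := (tau n * (d + 1) + (tau n - 3) * tau n * (tau n + 1) + tau n + 1)%N.
have ex n : exists th : (D n.+1).-tuple R, forall x, cube a b x ->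
    `|realization (tau n.+1) th x - phi x| <= L * d%:R * (b - a) / n.+1%:R.
  have le1 : (2 * d * n.+1 + 2 <= tau n.+1)%N by rewrite /tau; lia.
  have le2 : (n.+1 ^ d <= tau n.+1 - 3)%N by rewrite /tau; lia.
  have B1 : 1 <= B by rewrite /B; lra.
  have LB : 0 <= L <= B by rewrite L0 /B; lra.
  have aB : `|a| <= B by rewrite /B; lra.
  have bB : `|b| <= B by rewrite /B; lra.
  have [th _ hth] := network_approximation (ltn0Sn n) le1 le2 (leqnn _) ab B1 LB aB bB
    phi01 philip.
  by exists th.
apply: (@measurable_fun_cvg _ _ _ _ (fun n x => realization (tau n.+1) (sval (cid (ex n))) x)).
  move=> n; apply: measurable_funTS.
  by apply: (measurable_realization _ (measurable_cst _)).
move=> x cx; apply/cvgrPdist_le => e e0.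
pose C := L * d%:R * (b - a).
exists (Num.truncn (C / e)) => // n /= hn; rewrite distrC.
apply: (le_trans (svalP (cid (ex n)) x cx)).
rewrite -/C ler_pdivrMr // mulrC -ler_pdivrMr //.
have C0 : 0 <= C / e.
  by apply: divr_ge0; [rewrite /C !mulr_ge0 // subr_ge0 ltW|exact: ltW].
have /andP[_ h] := truncn_itv C0; apply: (le_trans (ltW h)).
by rewrite ler_nat ltnS.
Qed.

Lemma measurable_select (d0 d1 : measure_display) (T : measurableType d0)
  (T' : measurableType d1) (f : T -> nat) (Y : nat -> T -> T') :
  measurable_fun setT f -> (forall k, measurable_fun setT (Y k)) ->
  measurable_fun setT (fun w => Y (f w) w).
Proof.
move=> mf mY _ B mB; rewrite setTI.
have -> : (fun w => Y (f w) w) @^-1` B = \bigcup_k (f @^-1` [set k] `&` Y k @^-1` B).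
  apply/seteqP; split => w /=; first by move=> h; exists (f w).
  by move=> [k _ [/= ->]].
apply: bigcupT_measurable => k; apply: measurableI.
  by rewrite -[X in measurable X]setTI; apply: mf.
by rewrite -[X in measurable X]setTI; apply: mY.
Qed.

(** The corners with all coordinates [a] and all coordinates [b] have positive distance, and a
    negative [L] would contradict the Lipschitz condition there. *)
Lemma lipschitz_cst_ge0 (R : realType) (d : nat) (L a b : R) (phi : d.-tuple R -> R) :
  (0 < d)%N -> a < b ->
  (forall x y, cube a b x -> cube a b y -> `|phi x - phi y| <= L * eucl_dist x y) ->
  0 <= L.
Proof.
move=> d0 ab philip.
pose x := [tuple a | i < d]; pose y := [tuple b | i < d].
have cx : cube a b x by move=> i; rewrite tnth_mktuple lexx ltW.
have cy : cube a b y by move=> i; rewrite tnth_mktuple lexx ltW.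
have h := le_trans (normr_ge0 _) (philip _ _ cx cy).
have : 0 < eucl_dist x y.
  rewrite sqrtr_gt0 (bigD1 (Ordinal d0)) //= ltr_wpDr //.
    by apply: sumr_ge0 => i _; exact: sqr_ge0.
  by rewrite !tnth_mktuple exprn_even_gt0 //= subr_eq0 lt_eqF.
by move=> e0; rewrite -(pmulr_lge0 _ e0).
Qed.

(** * Bounds on the cubes and properties of the selected parameter *)

Lemma par_cube (R : realType) (D : nat) (B : R) (th : D.-tuple R) (n : nat) :
  0 <= B -> cube (- B) B th -> `|par th n| <= B.
Proof.
move=> B0 cth; rewrite /par; case: (ltnP n D) => h.
  by rewrite -(tnth_nth 0 th (Ordinal h)) ler_norml; exact: cth.
by rewrite nth_default ?normr0 // size_tuple.
Qed.

Lemma par_dist (R : realType) (D : nat) (del : R) (th th' : D.-tuple R) (n : nat) :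
  0 <= del -> (forall i, `|tnth th i - tnth th' i| <= del) ->
  `|par th n - par th' n| <= del.
Proof.
move=> del0 hd; rewrite /par; case: (ltnP n D) => h.
  by rewrite -(tnth_nth 0 th (Ordinal h)) -(tnth_nth 0 th' (Ordinal h)).
by rewrite !nth_default ?subrr ?normr0 // size_tuple.
Qed.

Lemma realization_cube_lip (R : realType) (d D tau : nat) (a b B del : R)
  (th th' : D.-tuple R) (x : d.-tuple R) :
  (2 < tau)%N -> 1 <= B -> `|a| <= B -> `|b| <= B -> 0 <= del ->
  cube (- B) B th -> cube (- B) B th' -> cube a b x ->
  (forall i, `|tnth th i - tnth th' i| <= del) ->
  `|realization tau th x - realization tau th' x| <= lip_cst d tau B * del.
Proof.
move=> t3 B1 aB bB del0 cth cth' cx hd; have B0 : 0 <= B by lra.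
apply: realization_lip => // [n|n|i|n].
- exact: par_cube.
- exact: par_cube.
- have /andP[h1 h2] := cx i; move: aB bB; rewrite !ler_norml => /andP[? ?] /andP[? ?].
  by apply/andP; split; lra.
- exact: par_dist.
Qed.

(** A minimizer exists among the indices below [K], so [find] stops inside the list and its result
    satisfies the predicate. *)
Lemma kstar_argmin (R : realType) (d0 : measure_display) (T : measurableType d0)
  (d D : nat) (phi : d.-tuple R -> R) (X : nat -> T -> d.-tuple R)
  (Th : nat -> T -> D.-tuple R) (K M tau : nat) (w : T) (k : nat) :
  (k < K)%N ->
  emp_risk phi X M tau (Xi phi X Th K M tau w) w <= emp_risk phi X M tau (Th k w) w.
Proof.
move=> kK; pose E j := emp_risk phi X M tau (Th j w) w.
pose p k := [forall j : 'I_K, E k <= E j].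
have hp : has p (iota 0 K).
  apply/hasP; have [j _ hj] := @arg_minP _ _ _ (Ordinal kK) xpredT (fun j : 'I_K => E j) isT.
  exists (val j); first by rewrite mem_iota /=.
  by apply/forallP => i; exact: hj.
have := nth_find 0%N hp; rewrite nth_iota ?add0n; last by move: hp; rewrite has_find size_iota.
by move=> /forallP /(_ (Ordinal kK)).
Qed.

(** Allows [phi] to be replaced by a measurable function that agrees with it at the samples. *)
Lemma eq_Xi (R : realType) (d0 : measure_display) (T : measurableType d0)
  (d D : nat) (phi psi : d.-tuple R -> R) (X : nat -> T -> d.-tuple R)
  (Th : nat -> T -> D.-tuple R) (K M tau : nat) (w : T) :
  (forall m, phi (X m w) = psi (X m w)) ->
  Xi phi X Th K M tau w = Xi psi X Th K M tau w.
Proof.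
move=> e; rewrite /Xi /kstar; congr (Th _ w); apply: eq_find => k.
apply: eq_forallb => j; rewrite /emp_risk.
by congr (_ * _ <= _ * _); apply: eq_bigr => m _; rewrite e.
Qed.

Lemma measurable_Xi (R : realType) (d0 : measure_display) (T : measurableType d0)
  (d D : nat) (phi : d.-tuple R -> R) (X : nat -> T -> d.-tuple R)
  (Th : nat -> T -> D.-tuple R) (K M tau : nat) :
  measurable_fun setT phi -> (forall m, measurable_fun setT (X m)) ->
  (forall k, measurable_fun setT (Th k)) ->
  measurable_fun setT (Xi phi X Th K M tau).
Proof.
move=> mphi mX mTh.
have mE k : measurable_fun setT (fun w => emp_risk phi X M tau (Th k w) w).
  apply: measurable_funM => //; apply: measurable_sum => m.
  apply: (@measurable_funX _ _ _ _ _ 2%N); apply: measurable_funB.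
    exact: measurable_realization.
  exact: (measurableT_comp mphi (mX m)).
exact: (measurable_select (measurable_argmin K mE) mTh).
Qed.

(** A Tonelli argument on the product of parameter space and sample space. Composed with the random
    parameter it yields measurability of the error event. *)
Lemma measurable_population_risk (R : realType) (d0 : measure_display)
  (T : measurableType d0) (P : probability T R) (d D tau : nat)
  (phi : d.-tuple R -> R) (X0 : T -> d.-tuple R) :
  measurable_fun setT phi -> measurable_fun setT X0 ->
  measurable_fun setT (fun th : D.-tuple R =>
    \int[P]_w (`|realization tau th (X0 w) - phi (X0 w)|%:E))%E.
Proof.
move=> mphi mX.
pose f (z : D.-tuple R * T) := (`|realization tau z.1 (X0 z.2) - phi (X0 z.2)|%:E)%E.
have mX2 : measurable_fun setT (fun z : D.-tuple R * T => X0 z.2).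
  exact: (measurableT_comp mX measurable_snd).
apply: (measurable_fun_fubini_tonelli_F (m2 := P) f); last first.
  by move=> z; rewrite lee_fin.
apply/measurable_EFinP; apply: (measurableT_comp (@normr_measurable _ _)) => //.
apply: measurable_funB; first by apply: measurable_realization.
exact: (measurableT_comp mphi mX2).
Qed.

(** With [n] the integer part of [z] plus 1, [n + 1 <= z + 2] gives [2 * d * (n + 1) ^ d <= tau].
    This dominates [2 * d * (n + 1)], hence the width, and [2 * (n + 1) ^ d >= 2 * n ^ d + 2 >= n ^
    d + 3], hence the depth. *)
Lemma grid_size (R : realType) (d tau : nat) (z : R) : (0 < d)%N -> 0 <= z ->
  2 * d%:R * (z + 2) ^+ d <= tau%:R ->
  exists n, [/\ (0 < n)%N, z <= n%:R, (2 * d * n + 2 <= tau)%N & (n ^ d <= tau - 3)%N].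
Proof.
move=> d0 z0 htau; have /andP[t1 t2] := truncn_itv z0.
pose n := (Num.truncn z).+1; exists n.
have h : (2 * d * n.+1 ^ d <= tau)%N.
  rewrite -(ler_nat R); apply: le_trans htau; rewrite !natrM natrX.
  apply: ler_wpM2l => //; apply: lerXn2r; rewrite ?nnegrE //; first lra.
  by rewrite /n -natr1 -natr1; lra.
have h1 : (n.+1 <= n.+1 ^ d)%N by rewrite -{1}(expn1 n.+1) leq_exp2l.
have h2 : (n ^ d < n.+1 ^ d)%N by rewrite ltn_exp2r.
have h3 : (0 < n ^ d)%N by rewrite expn_gt0.
split=> //; first exact: ltW.
- have : (2 * d * n.+1 <= tau)%N by apply: leq_trans h; rewrite leq_mul2l h1 orbT.
  by clear -d0; nia.
- have : (2 * n.+1 ^ d <= tau)%N by apply: leq_trans h; rewrite leq_mul2r; apply/orP; right; lia.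
  by clear -h2 h3; lia.
Qed.

(** The squares differ by [(u - v) * (u + v - 2 * p)], whose second factor is at most 2 in absolute
    value for values in [0,1]. *)
Lemma emp_risk_lip (R : realType) (d0 : measure_display) (T : measurableType d0)
  (d : nat) (phi : d.-tuple R -> R) (X : nat -> T -> d.-tuple R) (M tau : nat)
  (th th' : seq R) (w : T) (e : R) : (0 < M)%N ->
  (forall m, 0 <= phi (X m w) <= 1) ->
  (forall m, `|realization tau th (X m w) - realization tau th' (X m w)| <= e) ->
  emp_risk phi X M tau th w <= emp_risk phi X M tau th' w + 2 * e.
Proof.
move=> M0 phi01 he; rewrite /emp_risk.
have MR : 0 < M%:R :> R by rewrite ltr0n.
rewrite -(ler_pM2l MR) mulrDr !mulVKf ?gt_eqF // [M%:R * (2 * e)]mulr_natl.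
rewrite -[X in _ *+ X]card_ord -sumr_const -big_split /=; apply: ler_sum => m _.
have := he m; have := phi01 m.
have := realization_ge0_le1 tau th (X m w); have := realization_ge0_le1 tau th' (X m w).
move: (realization _ th _) (realization _ th' _) (phi _) => u v p.
move=> /andP[v0 v1] /andP[u0 u1] /andP[p0 p1]; rewrite ler_norml => /andP[e1 e2].
have -> : (u - p) ^+ 2 = (v - p) ^+ 2 + (u - v) * (u + v - 2 * p) by ring.
rewrite lerD2l; apply: (le_trans (ler_norm _)); rewrite normrM mulrC.
by apply: ler_pM => //; rewrite ler_norml; apply/andP; split; lra.
Qed.

Lemma emp_risk_le (R : realType) (d0 : measure_display) (T : measurableType d0)
  (d : nat) (phi : d.-tuple R -> R) (X : nat -> T -> d.-tuple R) (M tau : nat)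
  (th : seq R) (w : T) (e : R) : (0 < M)%N ->
  (forall m, `|realization tau th (X m w) - phi (X m w)| <= e) ->
  emp_risk phi X M tau th w <= e ^+ 2.
Proof.
move=> M0 he; have MR : 0 < M%:R :> R by rewrite ltr0n.
rewrite /emp_risk mulrC ler_pdivrMr // mulr_natr.
rewrite -[X in _ *+ X]card_ord -sumr_const; apply: ler_sum => m _.
rewrite -real_normK ?num_real //; apply: lerXn2r; rewrite ?nnegrE //.
exact: le_trans (normr_ge0 _) (he m).
Qed.

(** Integrates the pointwise comparison of the absolute error with the squared error. The bound on
    [v] makes its integral finite, so that [fine] loses nothing. *)
Lemma integral_affine_bound (R : realType) (d0 : measure_display) (T : measurableType d0)
  (P : probability T R) (u v : T -> R) (C s : R) :
  measurable_fun setT u -> measurable_fun setT v -> 0 <= C -> 0 <= s ->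
  (forall w, 0 <= u w) -> (forall w, 0 <= v w <= 1) ->
  (forall w, u w <= C + s * v w) ->
  (\int[P]_w (u w)%:E <= (C + s * fine (\int[P]_w (v w)%:E))%:E)%E.
Proof.
move=> mu mv C0 s0 u0 v01 uv.
have icst (c : R) : (\int[P]_w (cst c%:E w))%E = c%:E.
  rewrite integral_cst // -[RHS]mule1; congr (_ * _)%E; exact: probability_setT.
have v0 w : (0 <= (v w)%:E)%E by rewrite lee_fin; case/andP: (v01 w).
have mvE : measurable_fun setT (fun w => (v w)%:E) by apply/measurable_EFinP.
have vfin : (\int[P]_w (v w)%:E)%E \is a fin_num.
  rewrite ge0_fin_numE; last by apply: integral_ge0 => w _.
  apply: (@le_lt_trans _ _ (\int[P]_w (cst 1%:E w))%E); last first.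
    by rewrite icst ltry.
  by apply: ge0_le_integral => // w _; rewrite lee_fin; case/andP: (v01 w).
apply: (@le_trans _ _ (\int[P]_w (C%:E + s%:E * (v w)%:E))%E).
  apply: ge0_le_integral => //.
  - by move=> w _; rewrite lee_fin.
  - exact/measurable_EFinP.
  - apply: emeasurable_funD => //; apply: emeasurable_funM => //.
  - by move=> w _; rewrite -EFinM -EFinD lee_fin.
rewrite ge0_integralD //; last 2 first.
- by move=> w _; apply: mule_ge0.
- by apply: emeasurable_funM.
rewrite ge0_integralZl_EFin // (icst C).
by rewrite EFinD EFinM fineK.
Qed.

(** A union bound over [I]. The lower tail suffices, since a small empirical risk has to imply a
    small population risk. *)
Lemma uniform_deviation (R : realType) (d0 d1 : measure_display) (T : measurableType d0)
  (T' : measurableType d1) (P : probability T R) (X : nat -> T -> T') (I : finType)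
  (g : I -> T' -> R) (M : nat) (t : R) :
  iid P X -> (forall i, measurable_fun setT (g i)) -> (forall i x, 0 <= g i x <= 1) ->
  0 < t ->
  exists A : set T, [/\ measurable A,
    (P A <= (#|I|%:R * expR (- (M%:R * t ^+ 2 / 8)))%:E)%E &
    forall w, ~ A w -> forall i,
      M%:R * (fine (\int[P]_w (g i (X 0%N w))%:E) - t) < \sum_(m < M) g i (X m w)].
Proof.
move=> iidX mg g01 t0.
pose F i := [set w | \sum_(m < M) g i (X m w) <=
  M%:R * (fine (\int[P]_w (g i (X 0%N w))%:E) - t)].
have mF i : measurable (F i) by exact: (measurable_sum_le _ _ iidX.1 (mg i)).
exists (\big[setU/set0]_(i : I) F i); split.
- exact: bigsetU_measurable.
- apply: (le_trans (measure_bigU_le _ _ _ mF)).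
  apply: (@le_trans _ _ (\sum_(i : I) (expR (- (M%:R * t ^+ 2 / 8)))%:E)).
    by apply: lee_sum => i _; exact: (bernstein_lower M iidX (mg i) (g01 i) t0).
  by rewrite sumEFin lee_fin sumr_const [leRHS]mulr_natl.
- move=> w nA i; rewrite ltNge; apply/negP => hF; apply: nA.
  by rewrite (bigD1 i) //=; left.
Qed.

(** The summand [8 ^ 3] of [c] serves the exponent of the concentration bound. The other summand
    ensures [17 * B * Lam <= (c * tau) ^ tau]: the Lipschitz constant uses [tau.-1] of the factors
    and the last one absorbs [17 * B]. Both the success probability per coordinate and the covering
    number follow from this. *)
Lemma bound_constants (R : realType) (d tau : nat) (B eps : R) :
  (2 < tau)%N -> 1 <= B -> 0 < eps -> eps <= 1 ->
  let Lam := lip_cst d tau B in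
  let c := 8 ^+ 3 + 17 * B * (2 * d.+1%:R * B ^+ 3) in
  let Q := (Num.truncn (B / (eps ^+ 2 / (16 * Lam)))).+1 in
  [/\ 0 < c, 8 ^+ 3 <= c,
    eps ^+ 2 / (c * tau%:R) ^+ tau <= eps / (4 * Lam) / (2 * B),
    B / Q%:R <= eps ^+ 2 / (16 * Lam) &
    Q%:R <= (c * tau%:R) ^+ tau * eps ^- 2].
Proof.
move=> t3 B1 e0 e1 Lam c Q; have B0 : 0 < B by lra.
have Lam1 : 1 <= Lam by exact: lip_cst_ge1.
have Lam0 : 0 < Lam by lra.
pose c0 := 2 * d.+1%:R * B ^+ 3.
have c01 : 1 <= c0.
  rewrite /c0; apply: mulr_ege1; last exact: exprn_ege1.
  by rewrite -natrM ler1n.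
have k0 : 0 < 8 ^+ 3 :> R by rewrite exprn_gt0 // ltr0n.
have hc : 8 ^+ 3 <= c by rewrite /c -/c0 lerDl; apply: mulr_ge0; lra.
have t1 : 1 <= tau%:R :> R by rewrite ler1n (ltn_trans _ t3).
have hW : 17 * B * Lam <= (c * tau%:R) ^+ tau.
  apply: (@le_trans _ _ ((17 * B * c0 * tau%:R) ^+ tau)); last first.
    have ct : 17 * B * c0 * tau%:R <= c * tau%:R by apply: ler_wpM2r; rewrite ?/c -?/c0 // lerDr ltW.
    have p0 : 0 <= 17 * B * c0 * tau%:R by apply: mulr_ge0 => //; apply: mulr_ge0; lra.
    by apply: lerXn2r => //; rewrite nnegrE // (le_trans p0).
  have t0 : (0 < tau)%N := ltn_trans (isT : (0 < 2)%N) t3.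
  have -> : (17 * B * c0 * tau%:R) ^+ tau =
    (17 * B * c0 * tau%:R) * (17 * B * c0 * tau%:R) ^+ tau.-1 by rewrite -exprS prednK.
  apply: ler_pM; [lra|lra| |].
    rewrite -mulrA; apply: ler_peMr; [lra|exact: mulr_ege1].
  apply: (le_trans (lip_cst_le d t3 B1)); rewrite -/c0.
  have c0t : 0 <= c0 * tau%:R by apply: mulr_ge0 => //; lra.
  have h : c0 * tau%:R <= 17 * B * c0 * tau%:R.
    by rewrite -[leRHS]mulrA; apply: ler_peMl => //; lra.
  by apply: lerXn2r => //; rewrite nnegrE // (le_trans c0t).
set W := (c * tau%:R) ^+ tau in hW *.
have BL : 1 <= B * Lam by exact: mulr_ege1.
have W0 : 0 < W by apply: lt_le_trans hW; rewrite -mulrA; lra.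
clearbody W Lam.
have r0 : 0 < eps ^+ 2 / (16 * Lam) by apply: divr_gt0; [exact: exprn_gt0|lra].
have BrE : B / (eps ^+ 2 / (16 * Lam)) = 16 * (B * Lam) * eps ^- 2.
  by field; rewrite !gt_eqF.
have Br0 : 0 <= B / (eps ^+ 2 / (16 * Lam)) by rewrite divr_ge0 // ltW.
have /andP[q1 q2] := truncn_itv Br0.
have Q0 : 0 < Q%:R :> R by rewrite ltr0n.
have em2 : 1 <= eps ^- 2 by rewrite invf_ge1 ?exprn_gt0 // exprn_ile1 // ltW.
split=> //; first exact: lt_le_trans k0 hc.
- have -> : eps / (4 * Lam) / (2 * B) = eps / (8 * (B * Lam)) by field; rewrite !gt_eqF.
  apply: ler_pM.
  + exact: sqr_ge0.
  + by rewrite invr_ge0 ltW.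
  + by apply: ler_iXnr => //; rewrite ltW.
  + by rewrite lef_pV2 ?posrE //; rewrite -mulrA in hW; lra.
- by rewrite ler_pdivrMr // mulrC -ler_pdivrMr // ltW.
(* Here 17 is 16 from the mesh plus 1 for rounding up to an integer number of cells. *)
- apply: (@le_trans _ _ (17 * (B * Lam) * eps ^- 2)); last first.
    by apply: ler_wpM2r; [rewrite ltW // invr_gt0 exprn_gt0|rewrite mulrA].
  rewrite /Q -natr1 (_ : 17 * (B * Lam) * eps ^- 2 = 16 * (B * Lam) * eps ^- 2 +
    (B * Lam) * eps ^- 2); last by ring.
  by apply: lerD; [rewrite -BrE|exact: mulr_ege1].
Qed.

Lemma amgm_sqr (R : realType) (q eps : R) : 0 < eps ->
  q <= eps / 2 + (2 * eps)^-1 * q ^+ 2.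
Proof.
move=> e0; rewrite -subr_ge0 (_ : _ - q = (2 * eps)^-1 * (q - eps) ^+ 2).
  by apply: mulr_ge0; [rewrite invr_ge0; lra|exact: sqr_ge0].
by field; rewrite gt_eqF.
Qed.

(** * Covering of the parameter cube and combination of the errors *)

Definition grid_center (R : realType) (D Q : nat) (B : R) (f : {ffun 'I_D -> 'I_Q}) :
  D.-tuple R := [tuple midpoint (- B) B Q (f i) | i < D].

Lemma grid_center_cube (R : realType) (D Q : nat) (B : R) (f : {ffun 'I_D -> 'I_Q}) :
  0 < B -> cube (- B) B (grid_center B f).
Proof. by move=> B0 i; rewrite tnth_mktuple; apply: midpoint_itv; lra. Qed.

Lemma grid_center_near (R : realType) (D Q : nat) (B : R) (th : D.-tuple R) :
  0 < B -> (0 < Q)%N -> cube (- B) B th ->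
  exists f : {ffun 'I_D -> 'I_Q},
    forall i, `|tnth th i - tnth (grid_center B f) i| <= B / Q%:R.
Proof.
move=> B0 Q0 cth; have NB : - B < B by lra.
have near i := midpoint_near Q0 NB (cth i).
exists [ffun i => sval (cid (near i))] => i; rewrite tnth_mktuple ffunE.
apply: (le_trans (svalP (cid (near i)))); rewrite le_eqVlt; apply/orP; left; apply/eqP.
by field; rewrite pnatr_eq0 -lt0n.
Qed.

Lemma sqr_error_ge0_le1 (R : realType) (u v : R) :
  0 <= u <= 1 -> 0 <= v <= 1 -> 0 <= (u - v) ^+ 2 <= 1.
Proof.
move=> /andP[? ?] /andP[? ?]; rewrite sqr_ge0 /= -real_normK ?num_real // exprn_ile1 //.
by rewrite ler_norml; apply/andP; split; lra.
Qed.

(** The deterministic core. The good sample [thk] has sup error at most [eps / 2 + eps / 4], so its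
    empirical risk, and that of the minimizer [thm], is at most [9 / 16 * eps ^ 2]. Moving to the
    center [thc] adds [2 / 16 * eps ^ 2], and the deviation adds as much again, so the population
    risk of [thc] is at most [13 / 16 * eps ^ 2]. The L1 error of [thm] is then at most [eps ^ 2 /
    16 + eps / 2 + 13 / 32 * eps <= eps]. *)
Lemma minimizer_risk_le (R : realType) (d0 : measure_display) (T : measurableType d0)
  (P : probability T R) (d D M tau : nat) (a b B eps del r : R)
  (X : nat -> T -> d.-tuple R) (psi : d.-tuple R -> R)
  (ths thk thm thc : D.-tuple R) (w : T) :
  (2 < tau)%N -> 1 <= B -> `|a| <= B -> `|b| <= B -> (0 < M)%N -> 0 < eps -> eps <= 1 ->
  0 <= del -> 0 <= r ->
  lip_cst d tau B * del = eps / 4 -> lip_cst d tau B * r = eps ^+ 2 / 16 ->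
  cube (- B) B ths -> cube (- B) B thk -> cube (- B) B thm -> cube (- B) B thc ->
  (forall m, measurable_fun setT (X m)) -> (forall m v, cube a b (X m v)) ->
  measurable_fun setT psi -> (forall x, 0 <= psi x <= 1) ->
  (forall x, cube a b x -> `|realization tau ths x - psi x| <= eps / 2) ->
  (forall i, `|tnth thk i - tnth ths i| <= del) ->
  emp_risk psi X M tau thm w <= emp_risk psi X M tau thk w ->
  (forall i, `|tnth thm i - tnth thc i| <= r) ->
  fine (\int[P]_v ((realization tau thc (X 0%N v) - psi (X 0%N v)) ^+ 2)%:E) - eps ^+ 2 / 8 <
    emp_risk psi X M tau thc w ->
  (\int[P]_v (`|realization tau thm (X 0%N v) - psi (X 0%N v)|)%:E <= eps%:E)%E.
Proof.
move=> t3 B1 aB bB M0 e0 e1 del0 r0 Ldel Lr cs ck cm cc mX cX mpsi psi01 happrox hk hmin hc.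
have mreal (th : D.-tuple R) :
    measurable_fun setT (fun v => realization tau th (X 0%N v) - psi (X 0%N v)).
  apply: measurable_funB; last exact: measurableT_comp mpsi (mX _).
  by apply: measurable_realization.
have emp1 : emp_risk psi X M tau thk w <= (3 / 4 * eps) ^+ 2.
  apply: emp_risk_le => // m.
  have h1 := happrox _ (cX m w).
  have h2 := realization_cube_lip t3 B1 aB bB del0 ck cs (cX m w) hk.
  rewrite Ldel in h2; apply: (le_trans (ler_distD (realization tau ths (X m w)) _ _)); lra.
have emp2 : emp_risk psi X M tau thc w <= emp_risk psi X M tau thm w + 2 * (eps ^+ 2 / 16).
  rewrite -Lr; apply: emp_risk_lip => // m; rewrite distrC.
  exact: (realization_cube_lip t3 B1 aB bB r0 cm cc (cX m w) hc).
set mu := fine _ => hmu.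
(* Moving from [thm] to [thc] costs [eps ^ 2 / 16]; [amgm_sqr] then bounds the absolute error at
   [thc] by its square. *)
have bnd : (\int[P]_v (`|realization tau thm (X 0%N v) - psi (X 0%N v)|)%:E <=
    (eps ^+ 2 / 16 + eps / 2 + (2 * eps)^-1 * mu)%:E)%E.
  apply: (@integral_affine_bound _ _ _ _ _
    (fun v => (realization tau thc (X 0%N v) - psi (X 0%N v)) ^+ 2)).
  - by apply: (measurableT_comp (@normr_measurable _ _)).
  - by apply: measurable_funX.
  - by have := sqr_ge0 eps; lra.
  - by rewrite invr_ge0; lra.
  - by [].
  - by move=> v; apply: sqr_error_ge0_le1 => //; exact: realization_ge0_le1.
  - move=> v; apply: (le_trans (ler_distD (realization tau thc (X 0%N v)) _ _)).
    rewrite -addrA; apply: lerD.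
      by rewrite -Lr; exact: (realization_cube_lip t3 B1 aB bB r0 cm cc (cX 0%N v) hc).
    by rewrite -[X in _ <= _ + _ * X]real_normK ?num_real // amgm_sqr.
apply: (le_trans bnd); rewrite lee_fin.
have mub : mu <= 13 / 16 * eps ^+ 2.
  have h : (3 / 4 * eps) ^+ 2 = 9 / 16 * eps ^+ 2 by field.
  by clear bnd; lra.
have s0 : 0 <= (2 * eps)^-1 by rewrite invr_ge0; lra.
have := ler_wpM2l s0 mub.
have -> : (2 * eps)^-1 * (13 / 16 * eps ^+ 2) = 13 / 32 * eps by field; rewrite gt_eqF.
have : eps ^+ 2 <= eps by apply: ler_iXnr => //; exact: ltW.
lra.
Qed.

Lemma search_term_le (R : realType) (D K tau : nat) (c eps p : R) :
  0 <= c -> eps ^+ 2 / (c * tau%:R) ^+ tau <= p ->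
  expR (- (K%:R * p ^+ D)) <=
  expR (- (K%:R * (c * tau%:R) ^- (tau * D) * eps ^+ (2 * D))).
Proof.
move=> c0 hp; rewrite ler_expR lerN2 -[leLHS]mulrA; apply: ler_wpM2l => //.
have q0 : 0 <= eps ^+ 2 / (c * tau%:R) ^+ tau.
  by rewrite divr_ge0 ?sqr_ge0 // exprn_ge0 // mulr_ge0.
rewrite mulrC (exprM eps) (exprM (c * tau%:R)) -expr_div_n.
by apply: lerXn2r; rewrite ?nnegrE ?(le_trans q0).
Qed.

(** The covering number satisfies [Q ^ D <= expR (D * ln V)], and
    [(eps ^ 2 / 8) ^ 2 / 8 = eps ^ 4 / 8 ^ 3] explains the condition on [c]. *)
Lemma covering_term_le (R : realType) (D M Q : nat) (c eps V : R) :
  0 < eps -> 8 ^+ 3 <= c -> (0 < Q)%N -> Q%:R <= V ->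
  Q%:R ^+ D * expR (- (M%:R * (eps ^+ 2 / 8) ^+ 2 / 8)) <=
  2 * expR (D%:R * ln V - eps ^+ 4 * M%:R / c).
Proof.
move=> e0 hc Q0 hQ; have QR : 0 < Q%:R :> R by rewrite ltr0n.
have k0 : 0 < 8 ^+ 3 :> R by rewrite exprn_gt0 // ltr0n.
have c0 : 0 < c := lt_le_trans k0 hc.
have V0 : 0 < V by apply: lt_le_trans hQ.
have hV : Q%:R ^+ D <= expR (D%:R * ln V).
  by rewrite expRM_natl lnK ?posrE //; apply: lerXn2r; rewrite ?nnegrE ?(ltW V0).
apply: (@le_trans _ _ (expR (D%:R * ln V - eps ^+ 4 * M%:R / c))); last first.
  by apply: ler_peMl; [exact: expR_ge0|rewrite ler1n].
rewrite expRD; apply: ler_pM; rewrite ?exprn_ge0 ?expR_ge0 // ler_expR lerN2.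
have -> : M%:R * (eps ^+ 2 / 8) ^+ 2 / 8 = eps ^+ 4 * M%:R * (8 ^+ 3)^-1 by field.
apply: ler_wpM2l; first by rewrite mulr_ge0 // exprn_ge0 // ltW.
by rewrite lef_pV2.
Qed.

(* X m = X_{m+1};  Th D k = Theta_{D,k+1}  (0-based re-indexing). *)
Theorem theorem1p1 (R : realType) (d : nat) (L a b Rb : R)
  (d0 : measure_display) (T : measurableType d0) (P : probability T R)
  (X : nat -> T -> d.-tuple R) (phi : d.-tuple R -> R)
  (Th : forall D : nat, nat -> T -> D.-tuple R) :
  (0 < d)%N ->
  a < b ->
  2 <= Rb -> L <= Rb -> `|a| <= Rb -> `|b| <= Rb ->
  (forall m w, cube a b (X m w)) ->
  iid P X ->
  (forall x, cube a b x -> 0 <= phi x <= 1) ->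
  (forall x y, cube a b x -> cube a b y ->
     `|phi x - phi y| <= L * eucl_dist x y) ->
  (forall D k w, cube (- Rb) Rb (Th D k w)) ->
  (forall D, iid P (Th D)) ->
  (forall D, uniform_on_cube Rb P (Th D 0%N)) ->
  exists c : R, 0 < c /\
    forall (D K M tau : nat) (eps : R),
      (0 < K)%N -> (0 < M)%N -> 0 < eps -> eps <= 1 ->
      2 * d%:R * (2 * d%:R * L * (b - a) / eps + 2) ^+ d <= tau%:R ->
      (tau * (d + 1) + (tau - 3) * tau * (tau + 1) + tau + 1 <= D)%N ->
      (P [set w | (eps%:E <
           \int[pushforward P (X 0%N)]_(x in cube a b)
              (`| realization tau (Xi phi X (Th D) K M tau w) x - phi x |)%:E)%E]
      <= (expR (- (K%:R * (c * tau%:R) ^- (tau * D) * eps ^+ (2 * D)))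
          + 2 * expR (D%:R * ln ((c * tau%:R) ^+ tau * eps ^- 2)
                      - eps ^+ 4 * M%:R / c))%:E)%E.
Proof.
move=> d_gt0 ab R2 LR aR bR Xcube iidX phi01 philip Thcube iidTh uTh.
have L0 := lipschitz_cst_ge0 d_gt0 ab philip.
have B1 : 1 <= Rb by lra.
have B0 : 0 < Rb by lra.
have mX := iidX.1.
exists (8 ^+ 3 + 17 * Rb * (2 * d.+1%:R * Rb ^+ 3)); split.
  (* The constant does not depend on [tau] or [eps], so its positivity is read off at [tau = 3] and
     [eps = 1]. *)
  by have [] := bound_constants d (isT : (2 < 3)%N) B1 ltr01 (lexx 1).
move=> D K M tau eps K0 M0 e0 e1 htau leD.
have mTh := (iidTh D).1.
(* [phi] is arbitrary, possibly non-measurable, outside the cube. *)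
pose psi x := if x \in (cube a b : set (d.-tuple R)) then phi x else 0.
have mem_cube : (fun x => x \in (cube a b : set (d.-tuple R))) @^-1` [set true] = cube a b.
  by apply/seteqP; split => x /=; [move/set_mem|move/mem_set].
have mpsi : measurable_fun setT psi.
  have mcube := @measurable_cube R d a b.
  apply: measurable_fun_if => //.
  - by apply: (measurable_fun_bool true); rewrite setTI mem_cube.
  - by rewrite setTI mem_cube; exact: measurable_lipschitz_cube ab L0 phi01 philip.
have psiE x : cube a b x -> psi x = phi x by move=> cx; rewrite /psi mem_set.
have psi01 x : 0 <= psi x <= 1.
  by rewrite /psi; case: ifPn => [/set_mem /phi01 //|_]; rewrite lexx ler01.
pose xi w := Xi psi X (Th D) K M tau w.
have xiE w : Xi phi X (Th D) K M tau w = xi w.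
  by apply: eq_Xi => m; rewrite psiE //; exact: Xcube.
have xicube w : cube (- Rb) Rb (xi w) by exact: Thcube.
pose risk (th : D.-tuple R) := (\int[P]_w (`|realization tau th (X 0%N w) - psi (X 0%N w)|%:E))%E.
have mrisk : measurable_fun setT risk by exact: measurable_population_risk.
have mreal (th : D.-tuple R) : measurable_fun setT (fun x : d.-tuple R => realization tau th x).
  by apply: (measurable_realization _ (measurable_cst _)).
(* Change of variables: the samples lie in the cube, so its preimage under [X 0] is the whole
   space. *)
have riskE (th : D.-tuple R) : (\int[pushforward P (X 0%N)]_(x in cube a b)
    (`|realization tau th x - phi x|)%:E)%E = risk th.
  rewrite (eq_integral (fun x => (`|realization tau th x - psi x|)%:E)); last first.
    by move=> x /set_mem cx; rewrite psiE.
  rewrite ge0_integral_pushforward //.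
  - rewrite (_ : X 0%N @^-1` cube a b = setT) //.
    by apply/seteqP; split => // w _; exact: Xcube.
  - exact: measurable_cube.
  - apply: measurable_funTS; apply/measurable_EFinP.
    by apply: (measurableT_comp (@normr_measurable _ _)) => //; apply: measurable_funB.
have -> : [set w | (eps%:E < \int[pushforward P (X 0%N)]_(x in cube a b)
      (`|realization tau (Xi phi X (Th D) K M tau w) x - phi x|)%:E)%E] =
    [set w | (eps%:E < risk (xi w))%E].
  by apply/seteqP; split => w /=; rewrite riskE xiE.
have mxi : measurable_fun setT xi by apply: measurable_Xi.
have mE : measurable [set w | (eps%:E < risk (xi w))%E].
  rewrite -[X in measurable X]setTI.
  have mrxi : measurable_fun setT (risk \o xi) by exact: measurableT_comp.
  exact: (emeasurable_fun_o_infty measurableT mrxi).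
pose z := 2 * d%:R * L * (b - a) / eps.
have z0 : 0 <= z by apply: divr_ge0; [rewrite !mulr_ge0 //|]; lra.
have [n [n0 zn le1 le2]] := grid_size d_gt0 z0 htau.
have t3 : (2 < tau)%N.
  have nd : (0 < n ^ d)%N by rewrite expn_gt0 n0.
  by have := leq_trans nd le2; rewrite subn_gt0; exact: ltnW.
have LB : 0 <= L <= Rb by rewrite L0.
have [ths cths hths] := network_approximation n0 le1 le2 leD ab B1 LB aR bR phi01 philip.
(* [n >= z] with [z = 2 * d * L * (b - a) / eps] makes the approximation error at most [eps / 2]. *)
have approx x : cube a b x -> `|realization tau ths x - psi x| <= eps / 2.
  move=> cx; rewrite psiE //; apply: (le_trans (hths x cx)).
  have nR : 0 < n%:R :> R by rewrite ltr0n.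
  rewrite ler_pdivrMr //.
  have : z * eps <= n%:R * eps by apply: ler_wpM2r => //; exact: ltW.
  by rewrite /z divfK ?gt_eqF //; lra.
have [c0 hc hp hQ hN] := bound_constants d t3 B1 e0 e1.
move: c0 hc hp hQ hN; set c := 8 ^+ 3 + _ => c0 hc.
set Lam := lip_cst d tau Rb; set r := eps ^+ 2 / (16 * Lam).
set Q := (Num.truncn (Rb / r)).+1 => hp hQ hN.
have Lam0 : 0 < Lam := lt_le_trans ltr01 (lip_cst_ge1 d tau B1).
(* The two radii are scaled by [Lam]: [del] costs [eps / 4] in the realization, [r] costs
   [eps ^ 2 / 16]. *)
pose del := eps / (4 * Lam).
have L40 : 0 < 4 * Lam by apply: mulr_gt0.
have del0 : 0 < del by apply: divr_gt0.
have delR : del <= Rb.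
  rewrite ler_pdivrMr //; apply: (le_trans e1); apply: mulr_ege1 => //.
  by apply: mulr_ege1; [rewrite ler1n|exact: lip_cst_ge1].
have Lr : Lam * r = eps ^+ 2 / 16 by rewrite /r; field; rewrite gt_eqF.
have Ld : Lam * del = eps / 4 by rewrite /del; field; rewrite gt_eqF.
have r0 : 0 <= r by apply: divr_ge0; [exact: sqr_ge0|rewrite mulr_ge0 // ltW].
have t0 : 0 < eps ^+ 2 / 8 by apply: divr_gt0 => //; exact: exprn_gt0.
have hdel : 0 < del <= Rb by rewrite del0.
have [A1 [mA1 PA1 hA1]] := random_search K hdel (iidTh D) (uTh D) cths.
pose g (f : {ffun 'I_D -> 'I_Q}) (x : d.-tuple R) :=
  (realization tau (grid_center Rb f) x - psi x) ^+ 2.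
have mg f : measurable_fun setT (g f).
  by apply: measurable_funX; apply: measurable_funB.
have g01 f x : 0 <= g f x <= 1.
  by apply: sqr_error_ge0_le1 => //; exact: realization_ge0_le1.
have [A2 [mA2 PA2 hA2]] := uniform_deviation M iidX mg g01 t0.
apply: (@le_trans _ _ (P (A1 `|` A2))).
  apply: le_measure; rewrite ?inE //; first exact: measurableU.
  move=> w /= hw; apply: contrapT => /not_orP[nA1 nA2].
  have [k kK hk] := hA1 w nA1.
  (* The center depends on [w] through the trained parameter, which is why the deviation bound has
     to hold for all centers at once. *)
  have [f hf] := grid_center_near B0 (ltn0Sn _ : (0 < Q)%N) (xicube w).
  have hf' i := le_trans (hf i) hQ.
  move: hw; rewrite ltNge => /negP; apply.
  apply: (minimizer_risk_le t3 B1 aR bR M0 e0 e1 (ltW del0) r0 Ld Lr cths (Thcube D k w)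
    (xicube w) (grid_center_cube f B0) mX Xcube mpsi psi01 approx hk
    (kstar_argmin psi X (Th D) M tau w kK) hf').
  have MR : 0 < M%:R :> R by rewrite ltr0n.
  by rewrite /emp_risk [ltRHS]mulrC ltr_pdivlMr // [ltLHS]mulrC; exact: hA2.
apply: (le_trans (measureU2 P mA1 mA2)); rewrite EFinD; apply: leeD.
  by apply: (le_trans PA1); rewrite lee_fin; apply: search_term_le => //; exact: ltW.
apply: (le_trans PA2); rewrite lee_fin card_ffun !card_ord natrX.
exact: covering_term_le.
Qed.
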